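(* Let $\nu=(\nu_1,\ldots,\nu_M)$ be a symmetric composition of $N$, let $\mathcal D_a(u)$, $a=1,\ldots,M$, be the diagonal blocks of the block Gauss decomposition of the generator matrix $T(u)$ of $\mathrm X(\mathfrak g_N)$ associated with $\nu$, and let $z(u)$ be the central series defined by $T^t(u+\kappa)T(u)=z(u)1$. (i) If $M=2m+1$ is odd, then $$z(u)=\prod_{a=1}^{m}\frac{\mathrm{tr}\big(\widetilde{\mathcal D}_a(u+\kappa_{a+1})\mathcal D_a(u+\kappa_a)\big)}{\nu_a}\cdot\frac{\mathrm{tr}\big(\mathcal D_{m+1}^t(u+\kappa_{m+1})\mathcal D_{m+1}(u)\big)}{\nu_{m+1}}.$$ (ii) If $\mathfrak g_N$ is of type C and $M=2m$ is even, then $$z(u)=\prod_{a=1}^{m-1}\frac{\mathrm{tr}\big(\widetilde{\mathcal D}_a(u+\kappa_{a+1})\mathcal D_a(u+\kappa_a)\big)}{\nu_a}\cdot\frac{\mathrm{tr}\big(\mathcal D_m^t(u+\kappa_m)\mathcal D_{m+1}(u)\big)}{\nu_m}.$$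
   Context: Let $n\ge1$ and let $\mathfrak g_N$ be $\mathfrak o_N$ with $N=2n+1$ (type B) or $\mathfrak{sp}_N$ with $N=2n$ (type C), over $\mathbb C$. Put $i'=N+1-i$; $\varepsilon_i=1$ for all $i$ in type B; in type C, $\varepsilon_i=1$ for $i\le n$ and $\varepsilon_i=-1$ for $i>n$. Put $\kappa=N/2-1$ in type B and $\kappa=N/2+1$ in type C. Let $\mathsf P=\sum_{i,j}e_{ij}\otimes e_{ji}$, $\mathsf Q=\sum_{i,j}\varepsilon_i\varepsilon_j e_{ij}\otimes e_{i'j'}$, $R(u)=1-\frac{\mathsf P}{u}+\frac{\mathsf Q}{u-\kappa}$. The extended Yangian $\mathrm X(\mathfrak g_N)$ is the unital associative $\mathbb C$-algebra with generators $t_{ij}^{(r)}$ ($1\le i,j\le N$, $r\ge1$) and defining relations $R^{12}(u-v)T^{[1]}(u)T^{[2]}(v)=T^{[2]}(v)T^{[1]}(u)R^{12}(u-v)$ (superscripts indicate the matrix tensor factor), where $t_{ij}(u)=\delta_{ij}+\sum_{r\ge1}t_{ij}^{(r)}u^{-r}$, $T(u)=\sum_{i,j}t_{ij}(u)\otimes e_{ij}$. Put $T^t(u)=\sum_{i,j}\varepsilon_i\varepsilon_jt_{ij}(u)\otimes e_{j'i'}$. It is known that $T^t(u+\kappa)T(u)=T(u)T^t(u+\kappa)=z(u)1$ for a series $z(u)=1+\sum_{r\ge1}z^{(r)}u^{-r}$ whose coefficients generate the center of $\mathrm X(\mathfrak g_N)$. A composition $\nu=(\nu_1,\ldots,\nu_M)$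 of $N$ (positive parts) is symmetric if $\nu_a=\nu_{M+1-a}$ for all $a$. $N\times N$ matrices are viewed as $M\times M$ block matrices with $(a,b)$-block of size $\nu_a\times\nu_b$. The block Gauss decomposition is the unique factorization $T(u)=\mathcal F(u)\mathcal D(u)\mathcal E(u)$ with $\mathcal F(u)$ block lower unitriangular, $\mathcal D(u)=\mathrm{diag}[\mathcal D_1(u),\ldots,\mathcal D_M(u)]$, $\mathcal E(u)$ block upper unitriangular. Put $\widetilde{\mathcal D}_a(u)=\mathcal D_a(u)^{-1}$ and $\kappa_a=\kappa-\sum_{j=1}^{a-1}\nu_j$ (so $\kappa_1=\kappa$). With $\epsilon_i^a=\varepsilon_{\nu_1+\cdots+\nu_{a-1}+i}$, for a $\nu_a\times\nu_a$ matrix $A=\sum\alpha_{ij}\otimes e_{ij}$ in block position $(a,a)$ put $A^t=\sum\epsilon_i^a\epsilon_j^a\alpha_{ij}\otimes e_{\nu_a+1-j,\nu_a+1-i}$. $\mathrm{tr}$ denotes the sum of the diagonal entries (with values in $\mathrm X(\mathfrak g_N)[[u^{-1}]]$); shifted series are expanded in $u^{-1}$. *)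

(* Defs.v *)
From HB Require Import structures.
From mathcomp Require Import all_boot all_order all_algebra.
From mathcomp Require Import generic_quotient ring_quotient.
From mathcomp Require Import boolp reals complex mxtens.
From mathcomp Require Import monalg.

Set Implicit Arguments.
Unset Strict Implicit.
Unset Printing Implicit Defensive.

Import GRing.Theory.

Local Open Scope ring_scope.

(* [Series f] is the series  \sum_r f r * u^-r; the variable commutes with
   the coefficients.                                                        *)
Record series (A : Type) := Series { scoef : nat -> A }.

Notation "f `[ r ]" := (scoef f r) (at level 2, format "f `[ r ]").

Section SeriesZmod.
Variable A : zmodType.
Implicit Types f g : series A.

Lemma seriesP f g : (forall r, f`[r] = g`[r]) <-> f = g.
Proof. by split=> [|->//]; case: f g => [f] [g] /= /funext ->. Qed.

HB.instance Definition _ := gen_eqMixin (series A).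
HB.instance Definition _ := gen_choiceMixin (series A).

Definition sadd f g := Series (fun r => f`[r] + g`[r]).
Definition sopp f := Series (fun r => - f`[r]).
Definition szero : series A := Series (fun=> 0).

Fact saddA : associative sadd.
Proof. by move=> f g h; apply/seriesP=> r /=; rewrite addrA. Qed.
Fact saddC : commutative sadd.
Proof. by move=> f g; apply/seriesP=> r /=; rewrite addrC. Qed.
Fact sadd0 : left_id szero sadd.
Proof. by move=> f; apply/seriesP=> r /=; rewrite add0r. Qed.
Fact saddN : left_inverse szero sopp sadd.
Proof. by move=> f; apply/seriesP=> r /=; rewrite addNr. Qed.

HB.instance Definition _ :=
  GRing.isZmodule.Build (series A) saddA saddC sadd0 saddN.

Lemma scoefD f g r : (f + g)`[r] = f`[r] + g`[r]. Proof. by []. Qed.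
Lemma scoefN f r : (- f)`[r] = - f`[r]. Proof. by []. Qed.
Lemma scoefB f g r : (f - g)`[r] = f`[r] - g`[r]. Proof. by []. Qed.
Lemma scoef0 r : (0 : series A)`[r] = 0. Proof. by []. Qed.

Lemma scoef_sum I (s : seq I) (P : pred I) (F : I -> series A) r :
  (\sum_(i <- s | P i) F i)`[r] = \sum_(i <- s | P i) (F i)`[r].
Proof. exact: (big_morph (fun f : series A => f`[r])). Qed.

End SeriesZmod.

Section SeriesLmod.
Variables (K : pzRingType) (A : lmodType K).

Definition sscale (c : K) (f : series A) := Series (fun r => c *: f`[r]).

Fact sscaleA b c f : sscale b (sscale c f) = sscale (b * c) f.
Proof. by apply/seriesP=> r /=; rewrite scalerA. Qed.
Fact sscale1 : left_id 1 sscale.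
Proof. by move=> f; apply/seriesP=> r /=; rewrite scale1r. Qed.
Fact sscaleDr : right_distributive sscale +%R.
Proof. by move=> c f g; apply/seriesP=> r /=; rewrite scalerDr. Qed.
Fact sscaleDl f : {morph sscale^~ f : b c / b + c}.
Proof. by move=> b c; apply/seriesP=> r /=; rewrite scalerDl. Qed.

HB.instance Definition _ := GRing.Zmodule_isLmodule.Build K (series A)
  sscaleA sscale1 sscaleDr sscaleDl.

Lemma scoefZ c (f : series A) r : (c *: f)`[r] = c *: f`[r].
Proof. by []. Qed.

End SeriesLmod.

Section SeriesRing.
Variable A : nzRingType.
Implicit Types f g : series A.

Definition sconst (a : A) : series A :=
  Series (fun r => if r is 0%N then a else 0).

Definition uinv : series A := Series (fun r => (r == 1%N)%:R).

Definition smul f g := Series (fun r => \sum_(i < r.+1) f`[i] * g`[r - i]).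

Fact smul_rev f g r : (smul f g)`[r] = \sum_(i < r.+1) f`[r - i] * g`[i].
Proof.
rewrite /= (reindex_inj rev_ord_inj) /=.
by apply: eq_bigr => i _; rewrite subSS subKn // -ltnS.
Qed.

Fact smulA : associative smul.
Proof.
move=> f g h; apply/seriesP=> r; rewrite [RHS]smul_rev.
pose c j k := f`[j] * (g`[r - j - k] * h`[k]).
transitivity (\sum_(j < r.+1) \sum_(k < r.+1 | (k <= r - j)%N) c j k).
  apply: eq_bigr => j _; rewrite [X in _ * X]smul_rev big_distrr /=.
  by rewrite (big_ord_narrow_leq (leq_subr j r)).
rewrite (exchange_big_dep predT) //=; apply: eq_bigr => k _.
transitivity (\sum_(j < r.+1 | (j <= r - k)%N) c j k).
  apply: eq_bigl => j; rewrite -ltnS -(ltnS j) -!subSn ?leq_ord //.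
  by rewrite -subn_gt0 -(subn_gt0 j) -!subnDA addnC.
rewrite (big_ord_narrow_leq (leq_subr k r)) big_distrl /=.
by apply: eq_bigr => j _; rewrite /c -!subnDA addnC mulrA.
Qed.

Fact smul1 : left_id (sconst 1) smul.
Proof.
move=> f; apply/seriesP=> r /=; rewrite big_ord_recl subn0 mul1r.
by rewrite big1 ?addr0 // => i _; rewrite mul0r.
Qed.
Fact smulr1 : right_id (sconst 1) smul.
Proof.
move=> f; apply/seriesP=> r; rewrite smul_rev big_ord_recl subn0 mulr1.
by rewrite big1 ?addr0 // => i _; rewrite mulr0.
Qed.
Fact smulDl : left_distributive smul +%R.
Proof.
move=> f g h; apply/seriesP=> r /=; rewrite -big_split.
by apply: eq_bigr => i _; rewrite mulrDl.
Qed.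
Fact smulDr : right_distributive smul +%R.
Proof.
move=> f g h; apply/seriesP=> r /=; rewrite -big_split.
by apply: eq_bigr => i _; rewrite mulrDr.
Qed.
Fact sone_neq0 : sconst 1 != 0.
Proof. by apply/eqP => /seriesP/(_ 0%N)/eqP; rewrite oner_eq0. Qed.

HB.instance Definition _ := GRing.Zmodule_isNzRing.Build (series A)
  smulA smul1 smulr1 smulDl smulDr sone_neq0.

Lemma scoefM f g r : (f * g)`[r] = \sum_(i < r.+1) f`[i] * g`[r - i].
Proof. by []. Qed.
Lemma scoef1 r : (1 : series A)`[r] = (r == 0%N)%:R.
Proof. by case: r. Qed.

Fact sconst_zmod : zmod_morphism sconst.
Proof. by move=> a b; apply/seriesP=> -[|r] //=; rewrite subr0. Qed.
Fact sconst_monoid : monoid_morphism sconst.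
Proof.
split=> // a b; apply/seriesP=> r; rewrite scoefM big_ord_recl subn0.
rewrite big1 ?addr0 => [|i _]; last by rewrite mul0r.
by case: r => //= r; rewrite mulr0.
Qed.
HB.instance Definition _ :=
  GRing.isZmodMorphism.Build A (series A) sconst sconst_zmod.
HB.instance Definition _ :=
  GRing.isMonoidMorphism.Build A (series A) sconst sconst_monoid.

Lemma scoef_constM a f r : (sconst a * f)`[r] = a * f`[r].
Proof.
rewrite scoefM big_ord_recl subn0 big1 ?addr0 // => i _.
by rewrite mul0r.
Qed.

Lemma scoef_uinvM f r :
  (uinv * f)`[r] = if r is r'.+1 then f`[r'] else 0.
Proof.
rewrite scoefM; case: r => [|r]; first by rewrite big_ord1 /= mul0r.
rewrite 2!big_ord_recl /= mul0r add0r mul1r subSS subn0 big1 ?addr0 // => i _.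
by rewrite mul0r.
Qed.

End SeriesRing.

Arguments uinv {A}.

Section SeriesAlg.
Variables (K : comNzRingType) (A : algType K).

Fact sscaleAl (c : K) (f g : series A) : c *: (f * g) = (c *: f) * g.
Proof.
apply/seriesP=> r; rewrite scoefZ !scoefM scaler_sumr.
by apply: eq_bigr => i _; rewrite scalerAl.
Qed.
HB.instance Definition _ :=
  GRing.Lmodule_isLalgebra.Build K (series A) sscaleAl.

Fact sscaleAr (c : K) (f g : series A) : c *: (f * g) = f * (c *: g).
Proof.
apply/seriesP=> r; rewrite scoefZ !scoefM scaler_sumr.
by apply: eq_bigr => i _; rewrite scalerAr.
Qed.
HB.instance Definition _ :=
  GRing.Lalgebra_isAlgebra.Build K (series A) sscaleAr.

End SeriesAlg.

Section MapSeries.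

Definition map_series (A B : Type) (phi : A -> B) (f : series A) : series B :=
  Series (fun r => phi f`[r]).

Variables (A B : nzRingType) (phi : {rmorphism A -> B}).

Fact map_series_zmod : zmod_morphism (map_series phi).
Proof. by move=> f g; apply/seriesP=> r /=; rewrite rmorphB. Qed.
Fact map_series_monoid : monoid_morphism (map_series phi).
Proof.
split=> [|f g]; apply/seriesP=> r /=; first by case: r => [|r] /=;
  rewrite ?rmorph1 ?rmorph0.
by rewrite rmorph_sum; apply: eq_bigr => i _; rewrite rmorphM.
Qed.
HB.instance Definition _ :=
  GRing.isZmodMorphism.Build (series A) (series B) (map_series phi)
    map_series_zmod.
HB.instance Definition _ :=
  GRing.isMonoidMorphism.Build (series A) (series B) (map_series phi)
    map_series_monoid.

Lemma map_series_const a : map_series phi (sconst a) = sconst (phi a).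
Proof. by apply/seriesP=> -[|r] //=; rewrite rmorph0. Qed.
Lemma map_series_uinv : map_series phi uinv = uinv.
Proof. by apply/seriesP=> r /=; rewrite rmorph_nat. Qed.

End MapSeries.

Section Shift.
Variable K : fieldType.

(* (u + c)^-1 = \sum_(k >= 1) (- c)^(k-1) u^-k *)
Definition uinv_shift (c : K) : series K :=
  Series (fun k => if k is k'.+1 then (- c) ^+ k' else 0).

Lemma uinv_shiftE c : (1 + sconst c * uinv) * uinv_shift c = uinv.
Proof.
rewrite mulrDl mul1r -mulrA; apply/seriesP=> r.
rewrite scoefD scoef_constM scoef_uinvM.
case: r => [|[|r]] /=; first by rewrite mulr0 addr0.
  by rewrite mulr0 addr0.
by rewrite exprS mulNr addNr.
Qed.

(* f(u + c), the power u^-r being replaced by the expansion of (u + c)^-r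
   in u^-1; only the terms with r <= s contribute to u^-s.                  *)
Definition shift (A : lmodType K) (c : K) (f : series A) : series A :=
  Series (fun s => \sum_(r < s.+1) (uinv_shift c ^+ r)`[s] *: f`[r]).

End Shift.

Inductive two_sided_ideal (A : pzRingType) (S : A -> Prop) : A -> Prop :=
| ideal_gen x : S x -> two_sided_ideal S x
| ideal_0 : two_sided_ideal S 0
| ideal_D x y :
    two_sided_ideal S x -> two_sided_ideal S y -> two_sided_ideal S (x + y)
| ideal_Ml a x : two_sided_ideal S x -> two_sided_ideal S (a * x)
| ideal_Mr a x : two_sided_ideal S x -> two_sided_ideal S (x * a).

Section QuotientAlgebra.
Variables (K : comNzRingType) (A : algType K) (S : A -> Prop).

Definition in_ideal : {pred A} := fun x => `[< two_sided_ideal S x >].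

Fact in_idealP x : reflect (two_sided_ideal S x) (x \in in_ideal).
Proof. exact: asboolP. Qed.

Fact in_ideal_closed : zmod_closed in_ideal.
Proof.
split; first exact/in_idealP/ideal_0.
move=> x y /in_idealP Ix /in_idealP Iy; apply/in_idealP.
by apply: ideal_D => //; rewrite -mulN1r; apply: ideal_Ml.
Qed.

HB.instance Definition _ := GRing.isZmodClosed.Build A in_ideal
  in_ideal_closed.

(* [proper] makes the quotient a nonzero ring, as [algType] requires *)
Definition quot_alg (proper : ~ two_sided_ideal S 1) : Type :=
  {ideal_quot (in_ideal : zmodClosed A)}.

Variable proper : ~ two_sided_ideal S 1.
Local Notation Q := (quot_alg proper).

HB.instance Definition _ := GRing.Zmodule.copy Q {ideal_quot (in_ideal : zmodClosed A)}.

Definition quot_pi (x : A) : Q := \pi_({ideal_quot (in_ideal : zmodClosed A)})%qT x.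
Definition quot_repr (x : Q) : A := @repr _ {ideal_quot (in_ideal : zmodClosed A)} x.

Lemma quot_reprK : cancel quot_repr quot_pi.
Proof. by move=> x; rewrite /quot_pi /quot_repr reprK. Qed.

Lemma quot_piP x y : quot_pi x = quot_pi y <-> two_sided_ideal S (x - y).
Proof.
split=> [/eqP|] H.
  apply/in_idealP; move: H; rewrite /quot_pi.
  by rewrite -(Quotient.idealrBE (in_ideal : zmodClosed A)).
by apply/eqP; rewrite /quot_pi -(Quotient.idealrBE (in_ideal : zmodClosed A)); apply/in_idealP.
Qed.

Fact quot_pi_zmod : zmod_morphism quot_pi.
Proof. exact: pi_is_zmod_morphism. Qed.
HB.instance Definition _ := GRing.isZmodMorphism.Build A Q quot_pi
  quot_pi_zmod.

Definition quot_one : Q := quot_pi 1.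
Definition quot_mul (x y : Q) : Q := quot_pi (quot_repr x * quot_repr y).
Definition quot_scale (c : K) (x : Q) : Q := quot_pi (c *: quot_repr x).

Fact quot_mulE x y : quot_mul (quot_pi x) (quot_pi y) = quot_pi (x * y).
Proof.
have r_pi w : two_sided_ideal S (quot_repr (quot_pi w) - w).
  by apply/quot_piP; rewrite quot_reprK.
apply/quot_piP; set x' := quot_repr _; set y' := quot_repr _.
have -> : x' * y' - x * y = (x' - x) * y' + x * (y' - y).
  by rewrite mulrBl mulrBr addrA subrK.
by apply: ideal_D; [apply: ideal_Mr | apply: ideal_Ml]; apply: r_pi.
Qed.

Fact quot_scaleE c x : quot_scale c (quot_pi x) = quot_pi (c *: x).
Proof.
apply/quot_piP; rewrite -scalerBr -[_ - x]mul1r scalerAl.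
by apply: ideal_Ml; apply/quot_piP; rewrite quot_reprK.
Qed.

Fact quot_ind (P : Q -> Prop) : (forall x, P (quot_pi x)) -> forall x, P x.
Proof. by move=> H x; rewrite -[x]quot_reprK. Qed.

Fact quot_mulA : associative quot_mul.
Proof.
elim/quot_ind=> x; elim/quot_ind=> y; elim/quot_ind=> z.
by rewrite !quot_mulE mulrA.
Qed.
Fact quot_mul1 : left_id quot_one quot_mul.
Proof. by elim/quot_ind=> x; rewrite quot_mulE mul1r. Qed.
Fact quot_mulr1 : right_id quot_one quot_mul.
Proof. by elim/quot_ind=> x; rewrite quot_mulE mulr1. Qed.
Fact quot_mulDl : left_distributive quot_mul +%R.
Proof.
elim/quot_ind=> x; elim/quot_ind=> y; elim/quot_ind=> z.
by rewrite -raddfD !quot_mulE -raddfD mulrDl.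
Qed.
Fact quot_mulDr : right_distributive quot_mul +%R.
Proof.
elim/quot_ind=> x; elim/quot_ind=> y; elim/quot_ind=> z.
by rewrite -raddfD !quot_mulE -raddfD mulrDr.
Qed.
Fact quot_one_neq0 : quot_one != 0.
Proof.
apply/eqP; rewrite -(raddf0 quot_pi) /quot_one => /quot_piP.
by rewrite subr0; apply: proper.
Qed.

HB.instance Definition _ := GRing.Zmodule_isNzRing.Build Q
  quot_mulA quot_mul1 quot_mulr1 quot_mulDl quot_mulDr quot_one_neq0.

Fact quot_scaleA b c x : quot_scale b (quot_scale c x) = quot_scale (b * c) x.
Proof. by elim/quot_ind: x => x; rewrite !quot_scaleE scalerA. Qed.
Fact quot_scale1 : left_id 1 quot_scale.
Proof. by elim/quot_ind=> x; rewrite quot_scaleE scale1r. Qed.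
Fact quot_scaleDr : right_distributive quot_scale +%R.
Proof.
move=> c; elim/quot_ind=> x; elim/quot_ind=> y.
by rewrite -raddfD !quot_scaleE -raddfD scalerDr.
Qed.
Fact quot_scaleDl x : {morph quot_scale^~ x : b c / b + c}.
Proof.
by move=> b c; elim/quot_ind: x => x; rewrite !quot_scaleE -raddfD scalerDl.
Qed.

HB.instance Definition _ := GRing.Zmodule_isLmodule.Build K Q
  quot_scaleA quot_scale1 quot_scaleDr quot_scaleDl.

Fact quot_pi_monoid : monoid_morphism quot_pi.
Proof. by split=> // x y; rewrite -quot_mulE. Qed.
HB.instance Definition _ := GRing.isMonoidMorphism.Build A Q quot_pi
  quot_pi_monoid.

Lemma quot_piZ c x : quot_pi (c *: x) = c *: quot_pi x.
Proof. by rewrite -quot_scaleE. Qed.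

Fact quot_scaleAl (c : K) (x y : Q) : c *: (x * y) = (c *: x) * y.
Proof.
elim/quot_ind: x => x; elim/quot_ind: y => y.
by rewrite -rmorphM -!quot_piZ -rmorphM scalerAl.
Qed.
HB.instance Definition _ := GRing.Lmodule_isLalgebra.Build K Q quot_scaleAl.

Fact quot_scaleAr (c : K) (x y : Q) : c *: (x * y) = x * (c *: y).
Proof.
elim/quot_ind: x => x; elim/quot_ind: y => y.
by rewrite -rmorphM -!quot_piZ -rmorphM scalerAr.
Qed.
HB.instance Definition _ := GRing.Lalgebra_isAlgebra.Build K Q quot_scaleAr.

End QuotientAlgebra.

Section FreeAlgebra.
Variables (K : comNzRingType) (I : choiceType).

Fact malg_scaleAr (c : K) (x y : {malg K[{fmonom I}]}) :
  c *: (x * y) = x * (c *: y).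
Proof.
have cC (w : {malg K[{fmonom I}]}) : w * mkmalgU (mone : {fmonom I}) c = c *: w.
  rewrite malgM_def malgZ_def fgmulgU.
  by apply: eq_bigr => i _; rewrite mulm1 mulrC.
by rewrite -!cC mulrA.
Qed.

Definition free_alg : Type := {malg K[{fmonom I}]}.
HB.instance Definition _ := GRing.Lalgebra.on free_alg.
HB.instance Definition _ :=
  GRing.Lalgebra_isAlgebra.Build K free_alg malg_scaleAr.

Definition free_gen (i : I) : free_alg := mkmalgU (fmu i) 1.

End FreeAlgebra.

(* o_N with N = 2n + 1, respectively sp_N with N = 2n *)
Variant BC_type := TypeB | TypeC.

Definition dimN (g : BC_type) (n : nat) : nat :=
  if g is TypeB then n.*2.+1 else n.*2.

(* Indices are numbered from 0: i' is [rev_ord i], and the 1-based condition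
   i > n of type C is [n <= i] here.                                        *)
Definition eps (A : pzRingType) (g : BC_type) (n : nat) (i : nat) : A :=
  if g is TypeC then (if (n <= i)%N then -1 else 1) else 1.

Definition kappa (K : fieldType) (g : BC_type) (n : nat) : K :=
  if g is TypeB then (dimN g n)%:R / 2 - 1 else (dimN g n)%:R / 2 + 1.

(* A |-> A^t for a matrix whose first row and column have number [o] in the
   numbering of eps: sends  \sum a_ij (x) e_ij  to
   \sum eps_i eps_j a_ij (x) e_(j' i').                                     *)
Definition eps_tr (A : pzRingType) (g : BC_type) (n o p : nat) (B : 'M[A]_p) :
    'M[A]_p :=
  \matrix_(k, l) (eps A g n (o + rev_ord l) * eps A g n (o + rev_ord k)
                  * B (rev_ord l) (rev_ord k)).

Lemma eps_trE (A : pzRingType) g n o p (B : 'M[A]_p) :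
  eps_tr g n o B =
  \sum_(i < p) \sum_(j < p)
     (eps A g n (o + i) * eps A g n (o + j) * B i j)
       *: delta_mx (rev_ord j) (rev_ord i).
Proof.
apply/matrixP=> k l; rewrite !mxE summxE.
rewrite (bigD1 (rev_ord l)) //= summxE (bigD1 (rev_ord k)) //=.
rewrite !mxE !rev_ordK !eqxx mulr1 !big1 ?addr0 // => [i /negPf il|j /negPf jk].
  rewrite summxE big1 // => j _; rewrite !mxE -(inj_eq rev_ord_inj l).
  by rewrite rev_ordK [rev_ord l == i]eq_sym il andbF mulr0.
by rewrite !mxE -(inj_eq rev_ord_inj k) rev_ordK [rev_ord k == j]eq_sym jk mulr0.
Qed.

Section RTT.
Variables (K : fieldType) (g : BC_type) (n : nat).
Local Notation N := (dimN g n).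

Definition Pmx (A : nzRingType) : 'M[A]_(N * N) :=
  \sum_(i < N) \sum_(j < N) delta_mx i j *t delta_mx j i.

Definition Qmx (A : nzRingType) : 'M[A]_(N * N) :=
  \sum_(i < N) \sum_(j < N) (eps A g n i * eps A g n j)
     *: (delta_mx i j *t delta_mx (rev_ord i) (rev_ord j)).

Section Family.
Variable A : algType K.

(* [t i j r] stands for t_ij^(r+1) *)
Definition gen_mx (t : 'I_N -> 'I_N -> nat -> A) : 'M[series A]_N :=
  \matrix_(i, j)
    Series (fun r => if r is r'.+1 then t i j r' else (i == j)%:R).

(* A[[u^-1, v^-1]] is encoded as (A[[v^-1]])[[u^-1]]. *)
Local Notation series2 := (series (series A)).
Definition in_u (f : series A) : series2 := map_series (@sconst A) f.
Definition in_v (f : series A) : series2 := sconst f.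

(* u^-2 v^-2 (u - v) (u - v - kappa) R(u - v), a polynomial in x = u^-1 and
   y = v^-1: one has x y (u - v) = y - x.  The factor by which R(u - v) is
   multiplied is central and not a zero divisor.                            *)
Definition Rmx : 'M[series2]_(N * N) :=
  let x := in_u uinv in let y := in_v uinv in
  let d := y - x in let dk := y - x - kappa K g n *: (x * y) in
  (d * dk)%:M - (x * y * dk) *: Pmx series2 + (x * y * d) *: Qmx series2.

Definition T1 (T : 'M[series A]_N) : 'M[series2]_(N * N) :=
  map_mx in_u T *t 1%:M.
Definition T2 (T : 'M[series A]_N) : 'M[series2]_(N * N) :=
  1%:M *t map_mx in_v T.

Definition RTT_lhs (T : 'M[series A]_N) := Rmx *m T1 T *m T2 T.
Definition RTT_rhs (T : 'M[series A]_N) := T2 T *m T1 T *m Rmx.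

End Family.

Definition Ygen : choiceType := ('I_N * 'I_N * nat)%type.

Definition free_T : 'M[series (free_alg K Ygen)]_N :=
  gen_mx (fun i j r => free_gen K (i, j, r) : free_alg K Ygen).

Definition RTT_relator (x : free_alg K Ygen) : Prop :=
  exists (p q : 'I_(N * N)) (r s : nat),
    x = ((RTT_lhs free_T - RTT_rhs free_T) p q)`[r]`[s].

Section Functoriality.
Variables (A B : algType K) (phi : {rmorphism A -> B}).
Hypothesis phiZ : forall c a, phi (c *: a) = c *: phi a.

Local Notation phi2 := (map_series (map_series phi)).

Lemma map_gen_mx t :
  map_mx (map_series phi) (gen_mx t) = gen_mx (fun i j r => phi (t i j r)).
Proof.
apply/matrixP=> i j; rewrite !mxE; apply/seriesP=> -[|r] //=.
by rewrite rmorph_nat.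
Qed.

Lemma map_in_u f : phi2 (in_u f) = in_u (map_series phi f).
Proof. by apply/seriesP=> r /=; rewrite map_series_const. Qed.

Lemma map_in_v f : phi2 (in_v f) = in_v (map_series phi f).
Proof. exact: map_series_const. Qed.

Lemma map_tensmx m p q r (C : 'M[series (series A)]_(m, p)) (D : 'M_(q, r)) :
  map_mx phi2 (C *t D) = map_mx phi2 C *t map_mx phi2 D.
Proof. by apply/matrixP=> i j; rewrite !mxE rmorphM. Qed.

Lemma map_eps i :
  phi2 (eps (series (series A)) g n i) = eps (series (series B)) g n i.
Proof.
by rewrite /eps; case: g; [|case: ifP => _]; rewrite ?rmorphN rmorph1.
Qed.

Lemma map_Rmx : map_mx phi2 (Rmx A) = Rmx B.
Proof.
have scale2 c f : phi2 (c *: f) = c *: phi2 f.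
  by apply/seriesP=> r; apply/seriesP=> s /=; rewrite phiZ.
have uE : phi2 (in_u uinv) = in_u uinv by rewrite map_in_u map_series_uinv.
have vE : phi2 (in_v uinv) = in_v uinv by rewrite map_in_v map_series_uinv.
have PE : map_mx phi2 (Pmx _) = Pmx _.
  rewrite /Pmx map_mx_sum; apply: eq_bigr => i _.
  rewrite map_mx_sum; apply: eq_bigr => j _.
  by rewrite map_tensmx !map_delta_mx.
have QE : map_mx phi2 (Qmx _) = Qmx _.
  rewrite /Qmx map_mx_sum; apply: eq_bigr => i _.
  rewrite map_mx_sum; apply: eq_bigr => j _.
  by rewrite map_mxZ rmorphM /= !map_eps map_tensmx !map_delta_mx.
rewrite /Rmx map_mxD map_mxB [X in X - _]map_scalar_mx [X in _ - X]map_mxZ.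
rewrite [X in _ + X]map_mxZ PE QE !rmorphM /= !rmorphB.
by rewrite /= scale2 rmorphM /= uE vE.
Qed.

Lemma map_T1 T : map_mx phi2 (T1 T) = T1 (map_mx (map_series phi) T).
Proof.
rewrite /T1 map_tensmx map_scalar_mx rmorph1; congr (_ *t _).
by apply/matrixP=> i j; rewrite !mxE map_in_u.
Qed.

Lemma map_T2 T : map_mx phi2 (T2 T) = T2 (map_mx (map_series phi) T).
Proof.
rewrite /T2 map_tensmx map_scalar_mx rmorph1; congr (_ *t _).
by apply/matrixP=> i j; rewrite !mxE map_in_v.
Qed.

Lemma map_mxM3 (X Y Z : 'M[series (series A)]_(N * N)) X' Y' Z' :
    map_mx phi2 X = X' -> map_mx phi2 Y = Y' -> map_mx phi2 Z = Z' ->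
  map_mx phi2 (X *m Y *m Z) = X' *m Y' *m Z'.
Proof. by move=> <- <- <-; rewrite !map_mxM. Qed.

Lemma map_RTT_lhs T :
  map_mx phi2 (RTT_lhs T) = RTT_lhs (map_mx (map_series phi) T).
Proof. exact: map_mxM3 map_Rmx (map_T1 T) (map_T2 T). Qed.

Lemma map_RTT_rhs T :
  map_mx phi2 (RTT_rhs T) = RTT_rhs (map_mx (map_series phi) T).
Proof. exact: map_mxM3 (map_T2 T) (map_T1 T) map_Rmx. Qed.

Lemma map_coef_eq (X Y : 'M[series (series A)]_(N * N)) :
  map_mx phi2 X = map_mx phi2 Y <->
  forall p q r s, phi ((X - Y) p q)`[r]`[s] = 0.
Proof.
split=> [/matrixP XY p q r s | XY].
  have := congr1 (fun f => f`[r]`[s]) (XY p q).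
  by rewrite !mxE /= => E; rewrite rmorphB E subrr.
apply/matrixP=> p q; rewrite !mxE; apply/seriesP=> r; apply/seriesP=> s /=.
by apply/eqP; rewrite -subr_eq0 -rmorphB -(XY p q r s) !mxE.
Qed.

End Functoriality.

Lemma tensmx11 (A : pzRingType) p q :
  (1%:M : 'M[A]_p) *t (1%:M : 'M[A]_q) = 1%:M.
Proof.
apply/matrixP=> k l; case: (mxtens_indexP k) => i j.
case: (mxtens_indexP l) => i' j'; rewrite tensmxE !mxE -natrM mulnb.
by rewrite (can_eq (@mxtens_indexK p q)) xpair_eqE.
Qed.

Lemma RTT_1 (A : algType K) : RTT_lhs (1%:M : 'M[series A]_N) = RTT_rhs 1%:M.
Proof.
have T1E : T1 (1%:M : 'M[series A]_N) = 1%:M.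
  have uE : map_mx (@in_u A) 1%:M = 1%:M :> 'M_N.
    apply/matrixP=> i j; rewrite !mxE.
    exact: (rmorph_nat (map_series (@sconst A))).
  by rewrite /T1 uE tensmx11.
have T2E : T2 (1%:M : 'M[series A]_N) = 1%:M.
  have vE : map_mx (@in_v A) 1%:M = 1%:M :> 'M_N.
    by apply/matrixP=> i j; rewrite !mxE; apply: (rmorph_nat (@sconst _)).
  by rewrite /T2 vE tensmx11.
have comm1 (X Y Z : 'M[series (series A)]_(N * N)) :
    Y = 1%:M -> Z = 1%:M -> X *m Y *m Z = Z *m Y *m X.
  by move=> -> ->; rewrite !mulmx1 mul1mx.
exact: comm1 T1E T2E.
Qed.

Lemma RTT_proper : ~ two_sided_ideal RTT_relator 1.
Proof.
pose phi : {rmorphism free_alg K Ygen -> K^o} := mcoeff (mone : {fmonom Ygen}).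
suff H x : two_sided_ideal RTT_relator x -> phi x = 0.
  by move/H; rewrite rmorph1; apply/eqP; rewrite oner_eq0.
elim=> {x} [x [p [q [r [s ->]]]]||x y _ Hx _ Hy|a x _ Hx|a x _ Hx].
- have phiZ c a : phi (c *: a) = c *: phi a by exact: mcoeffZ.
  have T0 : map_mx (map_series phi) free_T = 1%:M.
    rewrite map_gen_mx; apply/matrixP=> i j; rewrite !mxE.
    apply/seriesP=> -[|k] /=; first by case: eqP.
    rewrite [LHS]mcoeffU /= -val_eqE /= fmU fm1 mulr0n.
    by case: (i == j).
  have E : RTT_lhs (map_mx (map_series phi) free_T) =
           RTT_rhs (map_mx (map_series phi) free_T).
    by rewrite T0; apply: RTT_1.
  have {}E := etrans (map_RTT_lhs phiZ _)
                (etrans E (esym (map_RTT_rhs phiZ _))).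
  exact: (proj1 (map_coef_eq phi _ _) E p q r s).
- exact: rmorph0.
- by rewrite rmorphD /= Hx Hy addr0.
- by rewrite rmorphM /= Hx mulr0.
- by rewrite rmorphM /= Hx mul0r.
Qed.

Definition extYangian : algType K := quot_alg RTT_proper.

Definition Tmx : 'M[series extYangian]_N :=
  gen_mx (fun i j r => quot_pi RTT_proper (free_gen K (i, j, r)) : extYangian).

Theorem Tmx_RTT : RTT_lhs Tmx = RTT_rhs Tmx.
Proof.
pose phi : {rmorphism free_alg K Ygen -> extYangian} := quot_pi RTT_proper.
have phiZ c a : phi (c *: a) = c *: phi a by exact: quot_piZ.
have TE : Tmx = map_mx (map_series phi) free_T by rewrite map_gen_mx.
have E : map_mx (map_series (map_series phi)) (RTT_lhs free_T) =
         map_mx (map_series (map_series phi)) (RTT_rhs free_T).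
  apply/map_coef_eq=> p q r s; rewrite -(rmorph0 phi).
  by apply/quot_piP; rewrite subr0; apply: ideal_gen; exists p, q, r, s.
rewrite TE.
exact: etrans (esym (map_RTT_lhs phiZ _)) (etrans E (map_RTT_rhs phiZ _)).
Qed.

End RTT.

Section BlockGauss.
Variables (A : nzRingType) (M : nat) (nu : 'I_M -> nat).
Local Notation sz := (\sum_(a < M) nu a)%N.

Definition block_lower_unitriangular (F : 'M[A]_sz) : Prop :=
  (forall a b : 'I_M, (a < b)%N -> submxblock F a b = 0) /\
  (forall a : 'I_M, submxblock F a a = 1%:M).

Definition block_upper_unitriangular (E : 'M[A]_sz) : Prop :=
  (forall a b : 'I_M, (b < a)%N -> submxblock E a b = 0) /\
  (forall a : 'I_M, submxblock E a a = 1%:M).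

Definition block_Gauss (T F : 'M[A]_sz) (D : forall a : 'I_M, 'M[A]_(nu a))
    (E : 'M[A]_sz) : Prop :=
  [/\ block_lower_unitriangular F, block_upper_unitriangular E
    & T = F *m (\mxdiag_(a < M) D a) *m E].

(* nu_1 + ... + nu_a (1-based): the number of rows above the 0-based block a *)
Definition psum (a : nat) : nat := (\sum_(j < M | j < a) nu j)%N.

End BlockGauss.

Definition is_mx_inverse (A : pzRingType) (p : nat) (B C : 'M[A]_p) : Prop :=
  B *m C = 1%:M /\ C *m B = 1%:M.

(* [kappa_ K g n nu a] is kappa_(a+1) = kappa - (nu_1 + ... + nu_a) *)
Definition kappa_ (K : fieldType) g n (M : nat) (nu : 'I_M -> nat) (a : nat) :
    K :=
  kappa K g n - (psum nu a)%:R.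

(* Main.v *)
(** Only relations without a Q-term are used. Let [[a, b], [c, d]] be a corner of
T with a of size k, write v = u - k and e = a(v)^-1 b(v). Taking the trace in the
commutators of the entries of a(u) and c(u) with e(v), which at u - v = k
simplify, gives
  b^T(u) = e^T a^T(u),   d^T(u) - e^T c^T(u) = f(u) (d - c a^-1 b)^T(v)
with f(u) = tr (a(v)^-1 a(u)) / k and ^T the transposition that keeps the order of
the factors. If a consists of the first blocks and d is the next one,
d - c a^-1 b is the Gauss factor of d. Together with the quantum Liouville formula
T^-1(u - N)^T T^T(u) = tr (T^-1(u - N) T(u)) / N, the second identity splits the
trace quotient of the first blocks into the factors of the individual blocks.
Finally, eliminating the rows and columns above the block r = c' of T turns
T^t(u + kappa) T(u) = z(u) into the identity of block c:
f(u + kappa) D_c^t(u + kappa_c) D_r(u) = z(u). *)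

From HB Require Import structures.
Require Import Defs.
From mathcomp Require Import all_boot all_order all_algebra.
From mathcomp Require Import reals complex mxtens zify.

Set Implicit Arguments.
Unset Strict Implicit.
Unset Printing Implicit Defensive.

Import GRing.Theory Num.Theory.
Local Open Scope ring_scope.

(** * Substitutions in power series *)

Section Substitution.
Variables (A B : nzRingType) (phi : {rmorphism A -> series B}) (w : series B).
Hypotheses (wC : forall f, GRing.comm w f) (w0 : w`[0] = 0).

(** The series f(w), with [phi] applied to the coefficients. Since [w] has no constant term, w^i
    starts in degree i, so degree s needs only the terms with i <= s. *)
Definition series_subst (f : series A) : series B :=
  Series (fun s => (\sum_(i < s.+1) phi f`[i] * w ^+ i)`[s]).

Lemma scoef_expr_lt i s : (s < i)%N -> (w ^+ i)`[s] = 0.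
Proof.
elim: i s => // i IHi s; rewrite ltnS exprS scoefM => le_si.
rewrite big_ord_recl /= w0 mul0r add0r big1 // => j _.
rewrite IHi ?mulr0 //; apply: leq_trans le_si.
by rewrite /= /bump add1n; case: s j => [[] //|s j]; rewrite subSS ltnS leq_subr.
Qed.

Lemma scoef_mul_expr_lt f i s : (s < i)%N -> (f * w ^+ i)`[s] = 0.
Proof.
move=> lt_si; rewrite scoefM big1 // => j _.
by rewrite scoef_expr_lt ?mulr0 // (leq_ltn_trans (leq_subr _ _)).
Qed.

Lemma scoef_series_subst f m s : (s < m)%N ->
  (series_subst f)`[s] = (\sum_(i < m) phi f`[i] * w ^+ i)`[s].
Proof.
move=> lt_sm; rewrite /= !scoef_sum (big_ord_widen m (fun i => (phi f`[i] * w ^+ i)`[s])) //.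
rewrite [RHS](bigID (fun i : 'I_m => (i < s.+1)%N)) /= [X in _ + X]big1 ?addr0 //.
by move=> i; rewrite -leqNgt => lt_si; apply: scoef_mul_expr_lt.
Qed.

Fact series_subst_zmod : zmod_morphism series_subst.
Proof.
move=> f g; apply/seriesP=> s; rewrite scoefB /= -scoefB -sumrB.
by congr (_`[s]); apply: eq_bigr => i _; rewrite rmorphB mulrBl.
Qed.

(** Centrality of [w] collects a product of two terms into [w ^+ (i + j)]; the pairs with i + j > s,
    which only the product of the truncations contains, do not reach degree s. *)
Fact series_subst_monoid : monoid_morphism series_subst.
Proof.
split=> [|f g].
  apply/seriesP=> s.
  transitivity ((\sum_(i < s.+1) phi (1 : series A)`[i] * w ^+ i)`[s]) => //.
  rewrite big_ord_recl scoef1 rmorph1 mul1r expr0 big1 ?addr0 // => i _.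
  by rewrite scoef1 rmorph0 mul0r.
apply/seriesP=> s; rewrite scoefM.
transitivity (((\sum_(i < s.+1) phi f`[i] * w ^+ i)
               * (\sum_(i < s.+1) phi g`[i] * w ^+ i))`[s]); last first.
  rewrite scoefM; apply: eq_bigr => i _.
  by rewrite -!scoef_series_subst ?ltnS ?leq_subr // -ltnS.
have wX i (h : series B) : w ^+ i * h = h * w ^+ i.
  by apply/esym/commrX/commr_sym.
pose c i j := phi (f`[i] * g`[j]) * w ^+ (i + j).
rewrite mulr_suml [RHS]scoef_sum.
transitivity (\sum_(r < s.+1) (phi (f * g)`[r] * w ^+ r)`[s]); first exact: scoef_sum.
transitivity (\sum_(r < s.+1) \sum_(i < s.+1 | (i <= r)%N) (c i (r - i)%N)`[s]).
  apply: eq_bigr => r _.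
  have lers : (r.+1 <= s.+1)%N by [].
  rewrite rmorph_sum mulr_suml scoef_sum /=.
  rewrite (big_ord_widen _ (fun i => (phi (f`[i] * g`[r - i]) * w ^+ r)`[s]) lers).
  by apply: eq_big => // i leir; rewrite /c subnKC.
rewrite (exchange_big_dep predT) //; apply: eq_bigr => i _.
rewrite mulr_sumr scoef_sum.
transitivity (\sum_(j < s.+1 | (j <= s - i)%N) (c i j)`[s]); last first.
  rewrite [LHS]big_mkcond; apply: eq_bigr => j _; rewrite /c.
  case: leqP => lts; first by rewrite rmorphM exprD !mulrA -[phi _ * w ^+ i * _]mulrA wX !mulrA.
  rewrite !mulrA -[phi _ * w ^+ i * _]mulrA wX mulrA -mulrA -exprD scoef_mul_expr_lt //.
  by rewrite -ltn_subLR // -ltnS.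
have lei : (i <= s)%N by rewrite -ltnS.
have lesi : (s - i < s.+1)%N by rewrite ltnS leq_subr.
rewrite [RHS](eq_bigl (fun j : 'I_s.+1 => (j < (s - i).+1)%N)) //.
rewrite -(big_ord_widen _ (fun j => (c i j)`[s]) lesi).
transitivity (\sum_(0 <= r < s.+1 | (i <= r)%N) (c i (r - i)%N)`[s]).
  by rewrite big_mkord; apply: eq_bigl.
transitivity (\sum_(0 <= j < (s - i).+1) (c i j)`[s]); last first.
  by rewrite big_mkord; apply: eq_bigl.
transitivity (\sum_(i <= r < s.+1) (c i (r - i)%N)`[s]).
  exact/esym/(big_nat_widenl i 0 s.+1 xpredT).
rewrite -{1}[nat_of_ord i]add0n big_addn subSn //.
by apply: eq_bigr => j _; rewrite addnK.
Qed.

End Substitution.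

(** * Schur complements and commutators *)

Section Bracket.
Variable B : nzRingType.

(** With [s] as a scalar matrix, the commutator obeys the Leibniz rule by associativity of the
    matrix product alone. *)
Definition bracket (s : B) p q (X : 'M[B]_(p, q)) : 'M_(p, q) :=
  s%:M *m X - X *m s%:M.

Lemma bracketE s p q (X : 'M[B]_(p, q)) i j :
  bracket s X i j = s * X i j - X i j * s.
Proof.
rewrite /bracket mul_scalar_mx !mxE; congr (_ - _).
by rewrite (bigD1 j) //= big1 ?addr0 => [|h /negPf nhj]; rewrite mxE ?eqxx ?nhj ?mulr0.
Qed.

Lemma bracketM s p q r (X : 'M[B]_(p, q)) (Y : 'M_(q, r)) :
  bracket s (X *m Y) = bracket s X *m Y + X *m bracket s Y.
Proof. by rewrite /bracket mulmxBl mulmxBr !mulmxA addrA subrK. Qed.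

Lemma bracketB s p q (X Y : 'M[B]_(p, q)) :
  bracket s (X - Y) = bracket s X - bracket s Y.
Proof. by rewrite /bracket mulmxBl mulmxBr !opprB addrACA [RHS]addrACA [- _ - _]addrC. Qed.

Lemma bracket_inv s p (X Y : 'M[B]_p) :
  Y *m X = 1%:M -> X *m Y = 1%:M -> bracket s Y = - (Y *m bracket s X *m Y).
Proof.
move=> YX XY; apply/eqP; rewrite -addr_eq0; apply/eqP.
rewrite -[X in X + _]mulmx1 -XY mulmxA -mulmxDl -bracketM YX.
by rewrite /bracket mulmx1 mul1mx subrr mul0mx.
Qed.

Lemma mulmx_col p q r (X : 'M[B]_(p, q)) (Y : 'M_(q, r)) i :
  X *m col i Y = col i (X *m Y).
Proof. by rewrite !colE mulmxA. Qed.

Lemma row_mulmx p q r (X : 'M[B]_(p, q)) (Y : 'M_(q, r)) i :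
  row i X *m Y = row i (X *m Y).
Proof. by rewrite !rowE mulmxA. Qed.

Lemma mulmx_Mnl p q r (X : 'M[B]_(p, q)) (Y : 'M_(q, r)) x :
  (X *m Y) *+ x = (X *+ x) *m Y.
Proof. by apply/esym/(raddfMn (mulmxr Y)). Qed.

Lemma mulmx_Mnr p q r (X : 'M[B]_(p, q)) (Y : 'M_(q, r)) x :
  (X *m Y) *+ x = X *m (Y *+ x).
Proof. by apply/esym/(raddfMn (mulmx X)). Qed.

Lemma colrowE p q r h (X : 'M[B]_(p, q)) (Y : 'M_(h, r)) s t i j :
  (col s X *m row t Y) i j = X i s * Y t j.
Proof. by rewrite mxE big_ord1 !mxE. Qed.

Lemma row_subE p q (X Y : 'M[B]_(p, q)) i : row i (X - Y) = row i X - row i Y.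
Proof. exact: linearB. Qed.

Lemma mx_subE p q (X Y : 'M[B]_(p, q)) i j : (X - Y) i j = X i j - Y i j.
Proof. by rewrite !mxE. Qed.

Section Schur.
Variables (x k m l : nat) (a a' ai' : 'M[B]_k) (b' : 'M[B]_(k, l))
  (C C' : 'M[B]_(m, k)) (E E' : 'M[B]_(m, l)).
Hypotheses (a'K : a' *m ai' = 1%:M) (ai'K : ai' *m a' = 1%:M).
Hypothesis Ca : forall p s,
  bracket (C p s) a' *+ x = col s a *m row p C' - col s a' *m row p C.
Hypothesis Cb : forall p s,
  bracket (C p s) b' *+ x = col s a *m row p E' - col s a' *m row p E.

(** Leibniz and the rule for the commutator with an inverse; [ai' *m a'] = 1 turns column s of [a']
    into a unit column, and the other terms pair up to E' - C' e and E - C e with e = a'^-1 b'. *)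
Lemma bracket_Schur p s :
  bracket (C p s) (ai' *m b') *+ x
    = col s (ai' *m a) *m row p (E' - C' *m (ai' *m b'))
      - col s 1%:M *m row p (E - C *m (ai' *m b')).
Proof.
rewrite bracketM (bracket_inv _ ai'K a'K) mulrnDl mulNmx mulNrn.
rewrite -!mulmxA mulmx_Mnr mulmx_Mnl Ca mulmx_Mnr Cb; set e := ai' *m b'.
rewrite !row_subE -!row_mulmx !mulmxBr mulmxBl mulmxBr -ai'K -!mulmx_col -!mulmxA.
by rewrite !opprB addrACA [RHS]addrACA; congr (_ + _); rewrite addrC.
Qed.

(** The entries (s, j) of [bracket_Schur] are summed over s. The unit columns contribute k copies of
    (E - C e)_pj; for x = k the terms C_ps e_sj cancel, and those with the factors in the opposite
    order remain. *)
Lemma trace_Schur p j : x = k ->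
  (E p j - \sum_s (ai' *m b') s j * C p s) *+ k
    = \tr (ai' *m a) * (E' - C' *m (ai' *m b')) p j.
Proof.
move=> xk; have H s : (C p s * (ai' *m b') s j - (ai' *m b') s j * C p s) *+ k
    = (ai' *m a) s s * (E' - C' *m (ai' *m b')) p j
      - (E - C *m (ai' *m b')) p j.
  have /matrixP/(_ s j) := bracket_Schur p s.
  rewrite !xk mulmxnE bracketE => ->; set e := ai' *m b'.
  by rewrite mx_subE !colrowE [1%:M _ _]mxE eqxx mul1r.
rewrite mulr_suml -[LHS]opprK.
have -> : \sum_i (ai' *m a) i i * (E' - C' *m (ai' *m b')) p j
  = \sum_s ((C p s * (ai' *m b') s j - (ai' *m b') s j * C p s) *+ k
     + (E - C *m (ai' *m b')) p j).
  by apply: eq_bigr => s _; rewrite H subrK.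
rewrite big_split /= sumr_const card_ord sumrMnl -mulrnDl sumrB opprK.
by rewrite mx_subE [(C *m _) p j]mxE addrC addrA subrK.
Qed.

End Schur.

(** Row r of a' times e = a'^-1 b' is row r of b'. Hence [a_rs, e] only retains row r of b - a e,
    which cancels against the commutators with c' and d'. *)
Lemma bracket_Schur0 x k l (a a' ai' : 'M[B]_k) (b b' : 'M_(k, l))
    (c c' : 'M_(l, k)) (d' : 'M_l) r s :
    a' *m ai' = 1%:M -> ai' *m a' = 1%:M ->
    bracket (a r s) a' *+ x = col s a *m row r a' - col s a' *m row r a ->
    bracket (a r s) b' *+ x = col s a *m row r b' - col s a' *m row r b ->
    bracket (a r s) c' *+ x = col s c *m row r a' - col s c' *m row r a ->
    bracket (a r s) d' *+ x = col s c *m row r b' - col s c' *m row r b ->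
  bracket (a r s) (d' - c' *m ai' *m b') *+ x = 0.
Proof.
move=> a'K ai'K Ha Hb Hc Hd.
have rb : row r a' *m (ai' *m b') = row r b' by rewrite row_mulmx mulmxA a'K mul1mx.
have He : bracket (a r s) (ai' *m b') *+ x
    = - (col s 1%:M *m (row r b - row r a *m (ai' *m b'))).
  rewrite bracketM (bracket_inv _ ai'K a'K) mulrnDl mulNmx mulNrn.
  rewrite -!mulmxA mulmx_Mnr mulmx_Mnl Ha mulmx_Mnr Hb.
  rewrite !mulmxBl !mulmxBr -!mulmxA rb.
  by rewrite opprB addrA subrK !mulmxA !mulmx_col ai'K opprB.
rewrite bracketB mulrnBl Hd -mulmxA bracketM mulrnDl mulmx_Mnl mulmx_Mnr Hc He.
rewrite mulmxN !mulmxBl mulmxBr -!mulmxA rb.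
rewrite mulmxBr !mulmxA !mulmx_col mulmx1 -!mulmxA !mulmxA opprB addrA.
by rewrite addrA subrK subrr.
Qed.

(** The rule for an inverse expresses [T_ij, (T'^-1)_jq]; in the sum over j the k copies of (T
    T'^-1)_iq cancel, and only the trace survives. *)
Lemma quantum_Liouville k (T T' Ti' : 'M[B]_k) i q :
    T' *m Ti' = 1%:M -> Ti' *m T' = 1%:M ->
    (forall i j, bracket (T i j) T' *+ k = col j T *m row i T' - col j T' *m row i T) ->
  (\sum_j Ti' j q * T i j) *+ k = \tr (Ti' *m T) * (i == q)%:R.
Proof.
move=> T'K Ti'K HT.
have H j : (T i j * Ti' j q - Ti' j q * T i j) *+ k
    = (T *m Ti') i q - (Ti' *m T) j j * (i == q)%:R.
  rewrite -bracketE -mulmxnE (bracket_inv _ Ti'K T'K) mulNrn -mulmxA mulmx_Mnr mulmx_Mnl HT.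
  rewrite mulmxBl mulmxBr -!mulmxA !row_mulmx T'K !mulmxA !mulmx_col Ti'K opprB.
  by rewrite mx_subE !colrowE ![1%:M _ _]mxE eqxx mul1r.
rewrite mulr_suml.
have -> : \sum_j (Ti' *m T) j j * (i == q)%:R
    = \sum_j ((T *m Ti') i q - (T i j * Ti' j q - Ti' j q * T i j) *+ k).
  by apply: eq_bigr => j _; rewrite H opprB addrC subrK.
rewrite sumrB sumr_const card_ord sumrMnl sumrB mulrnBl opprB.
by rewrite [(T *m Ti') i q]mxE addrC subrK.
Qed.

End Bracket.

(** * Shifts of the argument and evaluation of series in two variables *)

Section Shift.
Variables (K : fieldType) (A : algType K).

Definition scalar_series (f : series K) : series A := map_series (in_alg A) f.
Fact scalar_series_zmod : zmod_morphism scalar_series.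
Proof. exact: rmorphB. Qed.
Fact scalar_series_monoid : monoid_morphism scalar_series.
Proof. by split=> [|f h]; [exact: rmorph1 | exact: rmorphM]. Qed.
HB.instance Definition _ :=
  GRing.isZmodMorphism.Build (series K) (series A) scalar_series scalar_series_zmod.
HB.instance Definition _ :=
  GRing.isMonoidMorphism.Build (series K) (series A) scalar_series scalar_series_monoid.

Lemma scalar_series_comm f (h : series A) : GRing.comm (scalar_series f) h.
Proof.
apply/seriesP=> s; rewrite scoefM [RHS]smul_rev.
by apply: eq_bigr => i _; rewrite /= mulr_algl mulr_algr.
Qed.

(** The shift substitutes the central series (u + c)^-1 for u^-1; this makes it a ring morphism. *)
Lemma shift_substE (c : K) (f : series A) :
  shift c f = series_subst (@sconst A) (scalar_series (uinv_shift c)) f.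
Proof.
apply/seriesP=> s; rewrite [RHS]scoef_sum; apply: eq_bigr => i _.
by rewrite scoef_constM -rmorphXn /= mulr_algr.
Qed.

Lemma scalar_uinv_shift0 c : (scalar_series (uinv_shift c))`[0] = 0.
Proof. by rewrite /= scale0r. Qed.

Fact shift_zmod c : zmod_morphism (shift c : series A -> series A).
Proof. by move=> f g; rewrite !shift_substE series_subst_zmod. Qed.
Fact shift_monoid c : monoid_morphism (shift c : series A -> series A).
Proof.
have [H1 HM] := series_subst_monoid (@sconst A)
  (scalar_series_comm (uinv_shift c)) (scalar_uinv_shift0 c).
by split=> [|f g]; rewrite !shift_substE.
Qed.
HB.instance Definition _ c :=
  GRing.isZmodMorphism.Build (series A) (series A) (shift c) (shift_zmod c).
HB.instance Definition _ c :=
  GRing.isMonoidMorphism.Build (series A) (series A) (shift c) (shift_monoid c).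

Lemma shiftZ c a (f : series A) : shift c (a *: f) = a *: shift c f.
Proof.
apply/seriesP=> s /=; rewrite scaler_sumr; apply: eq_bigr => i _.
by rewrite !scalerA mulrC.
Qed.

Lemma shift_const c (a : A) : shift c (sconst a) = sconst a.
Proof.
rewrite shift_substE; apply/seriesP=> s; rewrite /= big_ord_recl.
rewrite big1 ?addr0 => [|i _]; last by rewrite rmorph0 mul0r.
by rewrite expr0 mulr1.
Qed.

Lemma uinv_reg (f : series A) : uinv * f = 0 -> f = 0.
Proof.
by move=> /seriesP Xf; apply/seriesP=> r; have := Xf r.+1; rewrite scoef_uinvM.
Qed.

Local Notation w c := (scalar_series (uinv_shift c)).

Lemma scalar_uinv_shiftE c : w c + c *: (uinv * w c) = uinv.
Proof.
have : (1 + scalar_series (sconst c) * scalar_series uinv) * w c = scalar_series uinv.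
  by rewrite -[in RHS](uinv_shiftE c) rmorphM rmorphD rmorph1 rmorphM.
have -> : scalar_series uinv = uinv by exact: map_series_uinv.
have -> : scalar_series (sconst c) = c *: 1.
  rewrite [LHS]map_series_const; apply/seriesP=> -[|r] //=; by rewrite ?scaler0.
by rewrite mulrDl mul1r -!scalerAl mul1r.
Qed.

Lemma shift_uinv c : shift c (uinv : series A) = w c.
Proof.
apply/seriesP=> -[|s]; rewrite /= big_ord_recl /=; first by rewrite big_ord0 !scaler0 addr0 scale0r.
rewrite scaler0 add0r big_ord_recl /= big1 ?addr0 => [|i _]; last by rewrite scaler0.
by [].
Qed.

(** The difference of 1/(u + be) and 1/(u + al). It is checked after multiplication by u^-1, where
    [scalar_uinv_shiftE] applies, and u^-1 is cancelled. *)
Lemma uinv_shiftB al be : w be - w al = (al - be) *: (w al * w be).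
Proof.
apply/eqP; rewrite -subr_eq0; apply/eqP/uinv_reg.
have Ea := congr1 (fun f => f * w be) (scalar_uinv_shiftE al).
have Eb := congr1 (fun f => f * w al) (scalar_uinv_shiftE be).
rewrite /= !mulrDl -!scalerAl -!mulrA in Ea Eb.
have wC : w be * w al = w al * w be by apply: scalar_series_comm.
rewrite !mulrBr -Ea -Eb wC -!scalerAr.
by rewrite opprD addrACA subrr add0r -scalerBl subrr.
Qed.

Lemma uinv_shift_reg c (f : series A) : w c * f = 0 -> f = 0.
Proof.
move=> wf; apply: uinv_reg; rewrite -(scalar_uinv_shiftE c).
by rewrite mulrDl -scalerAl -mulrA wf mulr0 scaler0 addr0.
Qed.

(* f(u, v) |-> f(u + al, u + be) *)
Definition series2_eval (al be : K) (f : series (series A)) : series A :=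
  series_subst (shift be) (scalar_series (uinv_shift al)) f.

Fact series2_eval_zmod al be : zmod_morphism (series2_eval al be).
Proof. exact: series_subst_zmod. Qed.
Fact series2_eval_monoid al be : monoid_morphism (series2_eval al be).
Proof.
by apply: series_subst_monoid; [exact: scalar_series_comm|exact: scalar_uinv_shift0].
Qed.
HB.instance Definition _ al be :=
  GRing.isZmodMorphism.Build (series (series A)) (series A)
    (series2_eval al be) (series2_eval_zmod al be).
HB.instance Definition _ al be :=
  GRing.isMonoidMorphism.Build (series (series A)) (series A)
    (series2_eval al be) (series2_eval_monoid al be).

Lemma series2_eval_in_u al be f : series2_eval al be (in_u f) = shift al f.
Proof.
rewrite shift_substE; apply/seriesP=> s; rewrite [LHS]scoef_sum [RHS]scoef_sum.
by apply: eq_bigr => i _; congr ((_ * _)`[s]); apply: shift_const.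
Qed.

Lemma series2_eval_in_v al be f : series2_eval al be (in_v f) = shift be f.
Proof.
apply/seriesP=> s; rewrite [LHS]/= big_ord_recl.
rewrite big1 ?addr0 => [|i _]; last by rewrite rmorph0 mul0r.
by rewrite expr0 mulr1.
Qed.

Lemma series2_evalZ al be a f : series2_eval al be (a *: f) = a *: series2_eval al be f.
Proof.
apply/seriesP=> s.
transitivity ((\sum_(i < s.+1) shift be (a *: f`[i]) * w al ^+ i)`[s]) => //.
rewrite -[RHS]/((a *: \sum_(i < s.+1) shift be f`[i] * w al ^+ i)`[s]).
by rewrite scaler_sumr; congr scoef; apply: eq_bigr => i _; rewrite shiftZ scalerAl.
Qed.

End Shift.

(** * The relations at numerically shifted arguments *)

Section Tensor.
Variables (g : BC_type) (n : nat) (B : nzRingType).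
Local Notation N := (dimN g n).
Local Notation "i ** j" := (mxtens_index (i, j)) (at level 30).

Lemma sum_mxtens (F : 'I_(N * N) -> B) :
  \sum_k F k = \sum_(i < N) \sum_(j < N) F (i ** j).
Proof.
rewrite pair_bigA /= (reindex (@mxtens_index N N)) /=; last first.
  by exists (@mxtens_unindex N N) => k _; rewrite ?mxtens_indexK ?mxtens_unindexK.
by apply: eq_bigr => -[].
Qed.

Lemma tens1_mulE (X Y : 'M[B]_N) i j p q :
  ((X *t 1%:M) *m (1%:M *t Y)) (i ** p) (j ** q) = X i j * Y p q.
Proof.
rewrite mxE sum_mxtens (bigD1 j) //= (bigD1 p) //= !tensmxE !mxE !eqxx mulr1 mul1r.
rewrite [X in _ + X + _]big1 => [|k /negPf nk].
  rewrite addr0 big1 ?addr0 // => k /negPf nk; rewrite big1 // => h _.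
  by rewrite !tensmxE !mxE nk mul0r mulr0.
by rewrite !tensmxE !mxE eq_sym nk mulr0 mul0r.
Qed.

Lemma tens1_mulE_rev (X Y : 'M[B]_N) i j p q :
  ((1%:M *t Y) *m (X *t 1%:M)) (i ** p) (j ** q) = Y p q * X i j.
Proof.
rewrite mxE sum_mxtens (bigD1 i) //= (bigD1 q) //= !tensmxE !mxE !eqxx mulr1 mul1r.
rewrite [X in _ + X + _]big1 => [|k /negPf nk].
  rewrite addr0 big1 ?addr0 // => k /negPf nk; rewrite big1 // => h _.
  by rewrite !tensmxE !mxE eq_sym nk mul0r mul0r.
by rewrite !tensmxE !mxE nk !mulr0.
Qed.

Lemma PmxE i j p q : Pmx g n B (i ** p) (j ** q) = ((i == q) && (p == j))%:R.
Proof.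
rewrite /Pmx summxE (bigD1 i) //= summxE (bigD1 j) //= tensmxE !mxE !eqxx !andTb.
rewrite mul1r big1 => [|k /negPf nk].
  rewrite addr0 big1 => [|k /negPf nk].
    by rewrite addr0 andbC [q == i]eq_sym.
  by rewrite summxE big1 // => h _; rewrite tensmxE !mxE eq_sym nk mul0r.
by rewrite tensmxE !mxE eqxx [j == k]eq_sym nk mul0r.
Qed.

Lemma Pmx_mulE (X : 'M[B]_(N * N)) i p k :
  (Pmx g n B *m X) (i ** p) k = X (p ** i) k.
Proof.
rewrite mxE sum_mxtens (bigD1 p) //= (bigD1 i) //= PmxE !eqxx mul1r.
rewrite [X in _ + X + _]big1 => [|h /negPf nh]; last by rewrite PmxE [i == h]eq_sym nh mul0r.
rewrite addr0 big1 ?addr0 // => h /negPf nh; rewrite big1 // => f _.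
by rewrite PmxE [p == h]eq_sym nh andbF mul0r.
Qed.

Lemma mul_PmxE (X : 'M[B]_(N * N)) j q k :
  (X *m Pmx g n B) k (j ** q) = X k (q ** j).
Proof.
rewrite mxE sum_mxtens (bigD1 q) //= (bigD1 j) //= PmxE !eqxx mulr1.
rewrite [X in _ + X + _]big1 => [|h /negPf nh]; last by rewrite PmxE nh andbF mulr0.
rewrite addr0 big1 ?addr0 // => h /negPf nh; rewrite big1 // => f _.
by rewrite PmxE nh mulr0.
Qed.

(** Row (i, p) of Q vanishes unless p = i'. Together with [mul_Qmx0] this is how the Q-terms
    disappear from the relations. *)
Lemma Qmx_mul0 (X : 'M[B]_(N * N)) i p k :
  p != rev_ord i -> (Qmx g n B *m X) (i ** p) k = 0.
Proof.
move=> nip; rewrite mxE big1 // => h _; case: (mxtens_indexP h) => a b.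
rewrite /Qmx summxE big1 ?mul0r // => i' _; rewrite summxE big1 // => j' _.
rewrite mxE tensmxE !mxE; case: (i =P i') => [<-|_]; last by rewrite mul0r mulr0.
by rewrite (negPf nip) !mulr0.
Qed.

Lemma mul_Qmx0 (X : 'M[B]_(N * N)) j q k :
  q != rev_ord j -> (X *m Qmx g n B) k (j ** q) = 0.
Proof.
move=> njq; rewrite mxE big1 // => h _; case: (mxtens_indexP h) => a b.
rewrite /Qmx summxE big1 ?mulr0 // => i' _; rewrite summxE big1 // => j' _.
rewrite mxE tensmxE !mxE; case: (j =P j') => [<-|_]; last by rewrite andbF mul0r mulr0.
by rewrite (negPf njq) andbF !mulr0.
Qed.

(** Taken from the entry at row (i, p) and column (j, q): both Q-terms vanish there, and P swaps i
    with p on the left and j with q on the right. The coefficients of R, with denominators cleared,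
    enter only as central elements. *)
Lemma RTT_entry (X Y : 'M[B]_N) (s0 s1 s2 : B) i j p q :
    (forall b, s0 * b = b * s0) -> (forall b, s1 * b = b * s1) ->
    (forall b, s2 * b = b * s2) ->
    let R := s0%:M - s1 *: Pmx g n B + s2 *: Qmx g n B in
    R *m (X *t 1%:M) *m (1%:M *t Y) = (1%:M *t Y) *m (X *t 1%:M) *m R ->
    p != rev_ord i -> q != rev_ord j ->
  s0 * (X i j * Y p q - Y p q * X i j) = s1 * (X p j * Y i q - Y p j * X i q).
Proof.
move=> s0C s1C s2C R; rewrite -mulmxA => RXY nip njq.
have mulZ (s : B) (U V : 'M[B]_(N * N)) :
    (forall b, s * b = b * s) -> U *m (s *: V) = s *: (U *m V).
  move=> sC; apply/matrixP=> k l; rewrite !mxE mulr_sumr.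
  by apply: eq_bigr => h _; rewrite mxE !mulrA sC.
have scalE (s : B) (U : 'M[B]_(N * N)) k l : (s%:M *m U) k l = s * U k l.
  by rewrite mul_scalar_mx mxE.
have mulscal (U : 'M[B]_(N * N)) : U *m s0%:M = s0%:M *m U.
  by rewrite mul_scalar_mx -scalemx1 mulZ // mulmx1.
have /matrixP/(_ (i ** p) (j ** q)) := RXY.
rewrite /R !mulmxDl !mulmxDr mulNmx mulmxN -!scalemxAl !mulZ // mulscal.
set U := _ *m (1%:M *t Y); set V := _ *m (X *t 1%:M).
have addE (W Z : 'M[B]_(N * N)) k l : (W + Z) k l = W k l + Z k l by rewrite mxE.
have oppE (W : 'M[B]_(N * N)) k l : (- W) k l = - W k l by rewrite mxE.
have sclE (s : B) (W : 'M[B]_(N * N)) k l : (s *: W) k l = s * W k l by rewrite mxE.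
rewrite !addE !oppE !scalE !sclE Qmx_mul0 // mul_Qmx0 // Pmx_mulE mul_PmxE.
rewrite !mulr0 !addr0 !tens1_mulE !tens1_mulE_rev => E.
rewrite !mulrBr; apply/eqP; rewrite subr_eq -addrA [- _ + _]addrC -E.
by rewrite addrC subrK.
Qed.

End Tensor.

Lemma uinv_comm (B : nzRingType) (f : series B) : uinv * f = f * uinv.
Proof.
apply/seriesP=> r; rewrite scoefM [RHS]smul_rev; apply: eq_bigr => i _.
by rewrite /= mulr_natl mulr_natr.
Qed.

Lemma sconst_comm (B : nzRingType) (a : B) (f : series B) :
  (forall b, a * b = b * a) -> sconst a * f = f * sconst a.
Proof.
move=> aC; apply/seriesP=> r; rewrite scoefM [RHS]smul_rev.
by apply: eq_bigr => -[[|i] lti] _ /=; rewrite ?mul0r ?mulr0.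
Qed.

Section Relations.
Variables (K : fieldType) (g : BC_type) (n : nat) (A : algType K).
Variable T : 'M[series A]_(dimN g n).
Hypothesis RTT : RTT_lhs T = RTT_rhs T.
Local Notation N := (dimN g n).
Local Notation S c := (map_mx (shift c) T).
Local Notation w c := (scalar_series A (uinv_shift c)).

(** The relation in u and v is evaluated at u + al and u + be; it becomes an identity in one
    variable with the number al - be in place of u - v. *)
Lemma RTT_specialised al be i j p q :
    p != rev_ord i -> q != rev_ord j -> al - be != kappa K g n ->
  (al - be) *: (S al i j * S be p q - S be p q * S al i j)
    = S al p j * S be i q - S be p j * S al i q.
Proof.
move=> nip njq nk.
pose x := in_u uinv : series (series A); pose y := in_v uinv : series (series A).
pose d := y - x; pose dk := d - kappa K g n *: (x * y).
have xC (b : series (series A)) : x * b = b * x.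
  by rewrite /x /in_u map_series_uinv uinv_comm.
have yC (b : series (series A)) : y * b = b * y.
  by apply: sconst_comm => a; apply: uinv_comm.
have xyC b : x * y * b = b * (x * y) by rewrite -mulrA yC mulrA xC mulrA.
have dC b : d * b = b * d by rewrite mulrBl mulrBr xC yC.
have dkC b : dk * b = b * dk by rewrite mulrBl mulrBr dC -scalerAl -scalerAr xyC.
have mC u v : (forall b : series (series A), u * b = b * u) -> (forall b, v * b = b * v) ->
    forall b, u * v * b = b * (u * v).
  by move=> uC vC b; rewrite -mulrA vC mulrA uC mulrA.
have := @RTT_entry g n _ (map_mx (@in_u K A) T) (map_mx (@in_v K A) T) _ _ _ i j p q
  (mC _ _ dC dkC) (mC _ _ xyC dkC) (mC _ _ xyC dC) RTT nip njq.
have uE a b : map_mx (@in_u K A) T a b = in_u (T a b) by rewrite mxE.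
have vE a b : map_mx (@in_v K A) T a b = in_v (T a b) by rewrite mxE.
have SE c a b : S c a b = shift c (T a b) by rewrite mxE.
rewrite !uE !vE => /(congr1 (series2_eval al be)).
rewrite !(rmorphM, rmorphB) /= series2_evalZ rmorphM /= !series2_eval_in_u !series2_eval_in_v.
rewrite !shift_uinv uinv_shiftB.
rewrite !SE.
set X := _ * _ - _; set Y := _ * _ - _.
set W := w al * w be; rewrite -scalerBl.
have Wreg f : W * f = 0 -> f = 0 by rewrite -mulrA => /uinv_shift_reg/uinv_shift_reg.
rewrite -!scalerAl -!scalerAr -!scalerAl => E.
(* The evaluation sends [d] to (al - be) W and [dk] to (al - be - kappa) W. Both sides thus carry
   W^2 and al - be - kappa; the scalar is nonzero and W is cancellable. *)
have nz : al - be - kappa K g n != 0 by rewrite subr_eq0.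
apply/eqP; rewrite -subr_eq0; apply/eqP/Wreg/Wreg.
apply: (scalerI nz); rewrite scaler0 [W * (W * _)]mulrA mulrBr scalerBr -scalerAr.
by rewrite [_ *: (_ *: _)]scalerA mulrC -scalerA E subrr.
Qed.

End Relations.

(** The Neumann series of G = 1 - X: as G has no constant term, G^m starts in degree m, so degree s
    of the inverse is read off the partial sum with s + 1 terms. *)
Lemma mx_series_inverse (A : nzRingType) p (X : 'M[series A]_p) :
  (forall i j, (X i j)`[0] = (i == j)%:R) -> exists Y, is_mx_inverse X Y.
Proof.
move=> X0; pose G := 1 - X; pose P m := \sum_(i < m) G ^+ i.
have G0 i j : (G i j)`[0] = 0.
  by rewrite !mxE scoefB X0; case: (i == j); rewrite /= subrr.
have Glt m i j s : (s < m)%N -> ((G ^+ m) i j)`[s] = 0.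
  elim: m i j s => // m IHm i j s ltsm; rewrite exprS mxE scoef_sum big1 // => h _.
  rewrite scoefM big_ord_recl G0 mul0r add0r big1 // => t _.
  rewrite IHm ?mulr0 //=; case: s ltsm t => [|s] ltsm [t ltt] //=.
  by rewrite /bump add1n subSS (leq_ltn_trans (leq_subr _ _)).
pose Y : 'M[series A]_p := \matrix_(i, j) Series (fun s => (P s.+1 i j)`[s]).
have YP m i j s : (s < m)%N -> (Y i j)`[s] = (P m i j)`[s].
  elim: m => // m IHm; rewrite ltnS leq_eqVlt => /predU1P[->|ltsm]; first by rewrite mxE.
  by rewrite IHm // {2}/P big_ord_recr mxE scoefD Glt // addr0.
have XP m : X * P m = 1 - G ^+ m.
  have GX : G - 1 = - X by rewrite addrC addKr.
  by rewrite -[LHS]opprK -mulNr -GX -subrX1 opprB.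
have PX m : P m * X = 1 - G ^+ m.
  rewrite -XP; suff /commr_sym c : GRing.comm X (P m) by [].
  apply: commr_sum => i _; apply: commrX; apply: commrB (commr_refl _).
  exact: commr1.
have subE (U V : 'M[series A]_p) a b : (U - V) a b = U a b - V a b by rewrite !mxE.
exists Y; split; apply/matrixP=> i j; apply/seriesP=> s.
  transitivity ((X * P s.+1) i j)`[s]; last first.
    by rewrite XP subE scoefB Glt // subr0.
  rewrite !mxE !scoef_sum; apply: eq_bigr => h _; rewrite !scoefM.
  by apply: eq_bigr => t _; rewrite (YP s.+1) // ltnS leq_subr.
transitivity ((P s.+1 * X) i j)`[s]; last first.
  by rewrite PX subE scoefB Glt // subr0.
rewrite !mxE !scoef_sum; apply: eq_bigr => h _; rewrite !scoefM.
by apply: eq_bigr => t _; rewrite (YP s.+1).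
Qed.

Section Psum.
Variables (M : nat) (nu : 'I_M -> nat).

Lemma psumS (a : 'I_M) : psum nu a.+1 = (psum nu a + nu a)%N.
Proof.
rewrite /psum (bigD1 a) //= addnC; congr (_ + _)%N; apply: eq_bigl => j.
by rewrite ltnS -val_eqE [RHS]ltn_neqAle andbC.
Qed.

Lemma leq_psum a b : (a <= b)%N -> (psum nu a <= psum nu b)%N.
Proof.
move=> leab; rewrite /psum [X in (_ <= X)%N](bigID (fun j : 'I_M => j < a)%N) /=.
apply: leq_trans (leq_addr _ _); apply/eq_leq/eq_bigl => j.
by case: ltnP => [/leq_trans->|]; rewrite ?andbF.
Qed.

Lemma psum0 : psum nu 0 = 0%N.
Proof. by rewrite /psum big_pred0. Qed.

Lemma psum_rev (c : 'I_M) : (forall a, nu (rev_ord a) = nu a) ->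
  (psum nu (rev_ord c) + nu c + psum nu c = \sum_a nu a)%N.
Proof.
move=> nu_sym; rewrite -nu_sym -psumS [RHS](bigID (fun j : 'I_M => j < (rev_ord c).+1)%N) /=.
congr (_ + _)%N; rewrite /psum (reindex_inj rev_ord_inj) /=.
apply: eq_big => [j|j _]; last exact: nu_sym.
rewrite -leqNgt; have := ltn_ord j; have := ltn_ord c; lia.
Qed.

End Psum.

(** * Block Gauss decomposition *)

Lemma sum_split3 (V : nmodType) N k l m (f : 'I_k -> 'I_N) (g : 'I_l -> 'I_N)
    (h : 'I_m -> 'I_N) (H : 'I_N -> V) :
    N = (k + l + m)%N -> (forall i, f i = i :> nat) ->
    (forall i, g i = k + i :> nat)%N -> (forall i, h i = k + l + i :> nat)%N ->
  \sum_i H i = \sum_i H (f i) + \sum_i H (g i) + \sum_i H (h i).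
Proof.
move=> NE; subst N => fE gE hE; rewrite !big_split_ord /=.
by congr (_ + _ + _); apply: eq_bigr => i _; congr (H _); apply: val_inj; rewrite /= ?fE ?gE ?hE.
Qed.

Section BlockElimination.
Variables (B : nzRingType) (N k l m : nat).
Variables (f : 'I_k -> 'I_N) (g : 'I_l -> 'I_N) (h : 'I_m -> 'I_N).
Hypotheses (NE : N = (k + l + m)%N) (fE : forall i, f i = i :> nat).
Hypothesis gE : forall i, (g i = k + i :> nat)%N.
Hypothesis hE : forall i, (h i = k + l + i :> nat)%N.
Variables (F D E T : 'M[B]_N) (ai : 'M[B]_k).
Hypothesis TFDE : T = F *m D *m E.
Hypothesis Funi : forall i j : 'I_N, (i <= j)%N -> F i j = (i == j)%:R.
Hypothesis Fblk : forall i j : 'I_N, (i < k + l)%N -> (k <= j)%N -> F i j = (i == j)%:R.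
Hypothesis Eblk : forall i j : 'I_N, (k <= i)%N -> (j < k + l)%N -> E i j = (i == j)%:R.
Hypothesis Dblk : forall i (j : 'I_N), ~~ (k <= j < k + l)%N -> D (g i) j = 0.
Hypotheses (aK : mxsub f f T *m ai = 1%:M).

(** Subtracting the columns f times a^-1 b from the columns g of T clears the rows f and leaves the
    Schur complement in the rows g. This matrix T w is also F y with y = D E w, and y is found by
    forward substitution. *)
Lemma block_elimination :
  mxsub g g T - mxsub g f T *m ai *m mxsub f g T = mxsub g g D.
Proof.
have fg i j : (f i == g j) = false.
  by apply/eqP => /(congr1 val)/=; rewrite fE gE; have := ltn_ord i; lia.
have fh i j : (f i == h j) = false.
  by apply/eqP => /(congr1 val)/=; rewrite fE hE; have := ltn_ord i; lia.
have gh i j : (g i == h j) = false.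
  by apply/eqP => /(congr1 val)/=; rewrite gE hE; have := ltn_ord i; lia.
have gg i j : (g i == g j) = (i == j) by rewrite -!val_eqE /= !gE eqn_add2l.
have ff i j : (f i == f j) = (i == j) by rewrite -!val_eqE /= !fE.
pose w := colsub g 1%:M - colsub f 1%:M *m (ai *m mxsub f g T).
have Tw : T *m w = colsub g T - colsub f T *m (ai *m mxsub f g T).
  by rewrite /w mulmxBr [_ *m (colsub f _ *m _)]mulmxA !mulmx_colsub !mulmx1.
pose y := D *m E *m w.
have Fy : F *m y = T *m w by rewrite TFDE !mulmxA.
have fy i q : (T *m w) (f i) q = 0.
  rewrite Tw; have /matrixP/(_ i q) : rowsub f (colsub g T - colsub f T *m (ai *m mxsub f g T)) = 0.
    have rowsubB (U V : 'M[B]_(N, l)) : rowsub f (U - V) = rowsub f U - rowsub f V.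
      by apply/matrixP=> a b; rewrite !mxE.
    by rewrite rowsubB -mul_rowsub_mx -!mxsubrc mulmxA aK mul1mx subrr.
  by rewrite mxE => ->; rewrite mxE.
(* The rows f of F y vanish and F is lower unitriangular, so the rows f of y vanish one after the
   other. *)
have y0 i q : y (f i) q = 0.
  have [s] := ubnP (i : nat); elim: s i => // s IHs i ltis.
  have := fy i q; rewrite -Fy mxE (sum_split3 _ NE fE gE hE).
  rewrite [X in _ + X]big1 => [|j _]; last first.
    by rewrite Funi ?fh ?mul0r // fE hE; have := ltn_ord i; lia.
  rewrite [X in _ + X + _]big1 => [|j _]; last first.
    by rewrite Funi ?fg ?mul0r // fE gE; have := ltn_ord i; lia.
  rewrite !addr0 (bigD1 i) //= Funi // eqxx mul1r big1 ?addr0 // => j nji.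
  have [ltji|leij] := ltnP j i; first by rewrite IHs ?mulr0 //; lia.
  by rewrite Funi ?fE // ff eq_sym (negPf nji) mul0r.
have gy i q : (T *m w) (g i) q = y (g i) q.
  rewrite -Fy mxE (sum_split3 _ NE fE gE hE).
  rewrite big1 ?add0r => [|j _]; last by rewrite y0 mulr0.
  rewrite [X in _ + X]big1 ?addr0 => [|j _]; last first.
    by rewrite Fblk ?gh ?mul0r // ?gE ?hE; have := ltn_ord i; lia.
  rewrite (bigD1 i) //= Fblk ?gE ?ltn_add2l ?leq_addr // eqxx mul1r big1 ?addr0 // => j nji.
  by rewrite Fblk ?gE ?ltn_add2l ?leq_addr // gg eq_sym (negPf nji) mul0r.
(* In the rows g and the columns f and g, E agrees with the identity; hence so does E w in the rows
   g, and y is the diagonal block of D there. *)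
have Ew i q : (E *m w) (g i) q = (i == q)%:R.
  have -> : E *m w = colsub g E - colsub f E *m (ai *m mxsub f g T).
    by rewrite /w mulmxBr [_ *m (colsub f _ *m _)]mulmxA !mulmx_colsub !mulmx1.
  rewrite mxE [X in _ + X]mxE [X in _ - X]mxE big1 => [|j _]; last first.
    rewrite mxE Eblk ?gE ?fE ?leq_addr ?(leq_trans (ltn_ord j)) ?leq_addr //.
    by rewrite eq_sym fg mul0r.
  by rewrite subr0 mxE Eblk ?gE ?leq_addr ?ltn_add2l // gg.
apply/matrixP=> i q; transitivity ((T *m w) (g i) q).
  rewrite Tw -mulmxA [LHS]mxE [RHS]mxE; congr (_ + _); first by rewrite !mxE.
  rewrite [LHS]mxE [RHS]mxE; congr (- _).
  by rewrite [LHS]mxE [RHS]mxE; apply: eq_bigr => j _; congr (_ * _); rewrite !mxE.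
rewrite gy /y -mulmxA mxE (sum_split3 _ NE fE gE hE) big1 => [|j _]; last first.
  by rewrite Dblk ?mul0r // fE; have := ltn_ord j; lia.
rewrite [X in _ + X]big1 => [|j _]; last by rewrite Dblk ?mul0r // hE; lia.
rewrite add0r addr0 (bigD1 q) //= Ew eqxx mulr1 big1 ?addr0 => [|j /negPf nj].
  by rewrite mxE.
by rewrite Ew nj mulr0.
Qed.

End BlockElimination.

Section BlockGauss.
Variables (A : nzRingType) (M : nat) (nu : 'I_M -> nat).

(** [tagnat.Rank b i] is the global index [psum nu b + i] of row i of block b. It translates the
    block conditions on F, D, E into the index inequalities of [block_elimination]. *)
Lemma block_Gauss_Schur N (NE : N = (\sum_(a < M) nu a)%N) (T : 'M[A]_N) F D E :
  block_Gauss (castmx (NE, NE) T) F D E ->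
  forall (a : 'I_M) (f : 'I_(psum nu a) -> 'I_N) (g : 'I_(nu a) -> 'I_N) ai,
    (forall i, f i = i :> nat) -> (forall i, g i = psum nu a + i :> nat)%N ->
    mxsub f f T *m ai = 1%:M ->
  mxsub g g T - mxsub g f T *m ai *m mxsub f g T = D a.
Proof.
subst N; rewrite castmx_id => -[[Fl F1] [Eu E1] TE] a f g ai fE gE aK.
set sz := (\sum_a nu a)%N in T F E TE f g fE gE aK Fl F1 Eu E1 *.
have le_sz : (psum nu a + nu a <= sz)%N.
  rewrite -psumS /sz (bigID (fun j : 'I_M => j < a.+1)%N) /=; exact: leq_addr.
pose m := (sz - (psum nu a + nu a))%N.
have szE : sz = (psum nu a + nu a + m)%N by rewrite subnKC.
have hP (i : 'I_m) : (psum nu a + nu a + i < sz)%N by rewrite szE ltn_add2l.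
pose h (i : 'I_m) : 'I_sz := Ordinal (hP i).
have RankE (b : 'I_M) (i : 'I_(nu b)) : (tagnat.Rank b i = psum nu b + i :> nat)%N.
  exact: tagnat.RankEsum.
have gR i : g i = tagnat.Rank a i by apply: ord_inj; rewrite gE RankE.
have lower (b c : 'I_M) (i : 'I_(nu b)) (j : 'I_(nu c)) :
    (tagnat.Rank b i <= tagnat.Rank c j)%N -> (b <= c)%N.
  rewrite !RankE => le_ij; rewrite leqNgt; apply/negP => ltcb.
  have := leq_psum nu ltcb; rewrite psumS; have := ltn_ord j; lia.
have diagE (X : 'M[A]_sz) (b : 'I_M) (i j : 'I_(nu b)) : submxblock X b b = 1%:M ->
    X (tagnat.Rank b i) (tagnat.Rank b j) = (tagnat.Rank b i == tagnat.Rank b j)%:R.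
  move=> /matrixP/(_ i j); rewrite !mxE => ->; congr (_ %:R)%R.
  by rewrite -(inj_eq (@ord_inj _) (tagnat.Rank b i)) !RankE eqn_add2l.
have zeroE (X : 'M[A]_sz) (b c : 'I_M) (i : 'I_(nu b)) (j : 'I_(nu c)) : b != c ->
    submxblock X b c = 0 ->
    X (tagnat.Rank b i) (tagnat.Rank c j) = (tagnat.Rank b i == tagnat.Rank c j)%:R.
  move=> nbc /matrixP/(_ i j); rewrite !mxE => ->.
  case: eqP => // /(congr1 (@nat_of_ord _)) bc; case/eqP: nbc.
  by apply: val_inj; apply/eqP; rewrite eqn_leq !(lower _ _ i j) ?(lower _ _ j i) // bc.
have RankP (i : 'I_sz) : exists b (i' : 'I_(nu b)), i = tagnat.Rank b i'.
  by exists (tagnat.sig1 i), (tagnat.sig2 i); rewrite tagnat.sig2K.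
have blkl (b : 'I_M) (i : 'I_(nu b)) : (tagnat.Rank b i < psum nu a + nu a)%N -> (b <= a)%N.
  rewrite RankE -psumS => lti; rewrite leqNgt; apply/negP => ltab.
  have := leq_psum nu ltab; lia.
have blkr (b : 'I_M) (i : 'I_(nu b)) : (psum nu a <= tagnat.Rank b i)%N -> (a <= b)%N.
  rewrite RankE => lei; rewrite leqNgt; apply/negP => ltba.
  have := leq_psum nu ltba; rewrite psumS; have := ltn_ord i; lia.
have Fle (b c : 'I_M) (i : 'I_(nu b)) (j : 'I_(nu c)) : (b <= c)%N ->
    F (tagnat.Rank b i) (tagnat.Rank c j) = (tagnat.Rank b i == tagnat.Rank c j)%:R.
  rewrite leq_eqVlt => /predU1P[/val_inj bc|ltbc].
    by subst c; apply: diagE.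
  by apply: zeroE; [rewrite neq_ltn ltbc | apply: Fl].
have Ele (b c : 'I_M) (i : 'I_(nu b)) (j : 'I_(nu c)) : (c <= b)%N ->
    E (tagnat.Rank b i) (tagnat.Rank c j) = (tagnat.Rank b i == tagnat.Rank c j)%:R.
  rewrite leq_eqVlt => /predU1P[/val_inj bc|ltbc].
    by subst c; apply: diagE.
  by apply: zeroE; [rewrite neq_ltn ltbc orbT | apply: Eu].
rewrite (block_elimination szE fE gE (h := h) _ TE) //.
- apply/matrixP=> i j; rewrite mxE !gR.
  by have /matrixP/(_ i j) := submxblock_diag D a; rewrite mxE.
- move=> i j; have [b [i' ->]] := RankP i; have [c [j' ->]] := RankP j.
  by move/lower; apply: Fle.
- move=> i j; have [b [i' ->]] := RankP i; have [c [j' ->]] := RankP j.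
  by move=> /blkl leba /blkr leac; apply: Fle; apply: leq_trans leac.
- move=> i j; have [b [i' ->]] := RankP i; have [c [j' ->]] := RankP j.
  by move=> /blkr leab /blkl leca; apply: Ele; apply: leq_trans leab.
move=> i j; have [c [j' ->]] := RankP j; rewrite gR => nj.
have nac : a != c.
  apply: contraNneq nj => ac; subst c; rewrite RankE leq_addr ltn_add2l.
  exact: ltn_ord.
(* The definition of [\mxdiag] unfolded, to read off that its off-diagonal blocks are zero. *)
have /matrixP/(_ i j') := mxblockK (fun i j =>
  if i == j then conform_mx 0 (D i) else (0 : 'M[A]_(nu i, nu j))) a c.
by rewrite mxE (negPf nac) [X in _ = X -> _]mxE.
Qed.

End BlockGauss.

(** * Corners of T and the relations without Q-term *)

Lemma bracket0P (B : nzRingType) (s : B) p q (X : 'M[B]_(p, q)) :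
  bracket s X = 0 <-> forall i j, s * X i j = X i j * s.
Proof.
split=> [/matrixP X0 i j|sX].
  by have := X0 i j; rewrite bracketE [RHS]mxE => /eqP; rewrite subr_eq0 => /eqP.
by apply/matrixP=> i j; rewrite bracketE sX subrr mxE.
Qed.

Lemma bracket0_inv (B : nzRingType) (s : B) p (X Y : 'M[B]_p) :
  is_mx_inverse X Y -> bracket s X = 0 -> bracket s Y = 0.
Proof. by move=> [XY YX] sX; rewrite (bracket_inv _ YX XY) sX mulmx0 mul0mx oppr0. Qed.

Section GlRelations.
Variables (B : nzRingType) (N : nat).
Hypothesis cancel : forall k (v w : B), (0 < k)%N -> v *+ k = w *+ k -> v = w.
Implicit Types S : 'M[B]_N.

Lemma mxsub_entry a b a' b' (X : 'M[B]_(a, b)) (f : 'I_a' -> 'I_a) (f' : 'I_b' -> 'I_b) u v :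
  mxsub f f' X u v = X (f u) (f' v).
Proof. by rewrite mxE. Qed.

(* The relations of T(u) = S and T(u - x) = S', restricted to pairs of rows and
   of columns in which the Q-term vanishes: j = i' would give i + j + 1 = N. *)
Definition gl_rel x S S' := forall i j p q : 'I_N,
  ((i + p).+1 < N)%N -> ((j + q).+1 < N)%N ->
  (S i j * S' p q - S' p q * S i j) *+ x = S p j * S' i q - S' p j * S i q.

(** An entry of one submatrix of S against a whole submatrix of S', in the shape to which the
    Leibniz rule applies. On the right-hand side the row sets are exchanged. *)
Definition bracket_rel x S S' p q p' q' (r : 'I_p -> 'I_N) (c : 'I_q -> 'I_N)
    (r' : 'I_p' -> 'I_N) (c' : 'I_q' -> 'I_N) := forall i j,
  bracket (mxsub r' c' S i j) (mxsub r c S') *+ x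
    = col j (mxsub r c' S) *m row i (mxsub r' c S')
      - col j (mxsub r c' S') *m row i (mxsub r' c S).

Lemma bracket_gl_rel x S S' p q p' q' (r : 'I_p -> 'I_N) (c : 'I_q -> 'I_N)
    (r' : 'I_p' -> 'I_N) (c' : 'I_q' -> 'I_N) :
    gl_rel x S S' -> (forall i h, (r' i + r h).+1 < N)%N ->
    (forall j h, (c' j + c h).+1 < N)%N ->
  bracket_rel x S S' r c r' c'.
Proof.
move=> SS Hr Hc i j; apply/matrixP=> h l.
by rewrite mulmxnE bracketE mx_subE !colrowE !mxsub_entry; apply: SS.
Qed.

Section Schur.
Variables (k l : nat) (f : 'I_k -> 'I_N) (h : 'I_l -> 'I_N).
Hypotheses (fE : forall i, f i = i :> nat) (hE : forall i, h i = (k + i)%N :> nat).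
Variables (S S' : 'M[B]_N) (ai : 'M[B]_k).
Hypothesis SS : gl_rel k S S'.
Hypothesis aiK : is_mx_inverse (mxsub f f S') ai.
Hypothesis le_kl : (k + k + l <= N)%N.
Hypothesis l_gt0 : (0 < l)%N.
Local Notation e := (ai *m mxsub f h S').

Let Hff : bracket_rel k S S' f f f f.
Proof.
apply: bracket_gl_rel SS _ _ => u v; rewrite ?hE ?fE;
  by have := ltn_ord u; have := ltn_ord v; lia.
Qed.
Let Hfh : bracket_rel k S S' f h f f.
Proof.
apply: bracket_gl_rel SS _ _ => u v; rewrite ?hE ?fE;
  by have := ltn_ord u; have := ltn_ord v; lia.
Qed.
Let Hhf : bracket_rel k S S' f f h f.
Proof.
apply: bracket_gl_rel SS _ _ => u v; rewrite ?hE ?fE;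
  by have := ltn_ord u; have := ltn_ord v; lia.
Qed.
Let Hhh : bracket_rel k S S' f h h f.
Proof.
apply: bracket_gl_rel SS _ _ => u v; rewrite ?hE ?fE;
  by have := ltn_ord u; have := ltn_ord v; lia.
Qed.
(** [trace_Schur] with C = a and E = b, where the Schur complement b - a a^-1 b is zero. *)
Lemma Schur_upper p j : S (f p) (h j) = \sum_s e s j * S (f p) (f s).
Proof.
have k0 : (0 < k)%N by apply: leq_trans (ltn_ord p).
have [K1 K2] := aiK.
have := trace_Schur K1 K2 Hff Hfh p j erefl.
rewrite mulmxA K1 mul1mx subrr [(0 : 'M__) _ _]mxE mulr0.
rewrite -[0](mul0rn _ k) => /(cancel k0) /eqP; rewrite subr_eq0 => /eqP.
by rewrite mxE => ->; apply: eq_bigr => s _; rewrite mxsub_entry.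
Qed.

Variable F : B.
Hypotheses (S0 : k = 0%N -> S = S') (F1 : k = 0%N -> F = 1).
Hypothesis FE : F *+ k = \tr (ai *m mxsub f f S).

(** [trace_Schur] with C = c and E = d, divided by k. For k = 0 the corner is empty, and S = S' and
    F = 1 give the identity. *)
Lemma Schur_lower p j :
  S (h p) (h j) - \sum_s e s j * S (h p) (f s)
    = F * (mxsub h h S' - mxsub h f S' *m ai *m mxsub f h S') p j.
Proof.
have [k0|k0] := posnP k.
  have nok (s : 'I_k) : False by have := leq_ltn_trans (leq0n s) (ltn_ord s); rewrite k0.
  rewrite F1 // mul1r big1 => [|s _]; last by case: (nok s).
  rewrite subr0 mx_subE [X in _ - X]mxE big1 ?subr0 => [|s _].
    by rewrite mxsub_entry S0.
  by case: (nok s).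
have [K1 K2] := aiK.
have := trace_Schur K1 K2 Hhf Hhh p j erefl.
rewrite -FE -mulmxA mulrnAl => /(cancel k0) <-; rewrite mxsub_entry.
by congr (_ - _); apply: eq_bigr => s _; rewrite mxsub_entry.
Qed.

End Schur.

(* S, S1, S2 stand for T(u), T(u - k), T(u - k - l). *)
Section Step.
Variables (k l : nat) (e : 'I_(k + l) -> 'I_N).
Hypothesis eE : forall i, e i = i :> nat.
Local Notation f := (fun i => e (lshift l i)).
Local Notation h := (fun i => e (rshift k i)).
Variables (S S1 S2 : 'M[B]_N) (a1i a2i : 'M[B]_k) (F : B).
Hypotheses (SS1 : gl_rel k S S1) (S0 : k = 0%N -> S = S1).
Hypotheses (SS2 : gl_rel (k + l) S S2) (S12 : gl_rel l S1 S2).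
Hypothesis lt_kl : ((k + l).*2 <= N)%N.
Hypothesis l_gt0 : (0 < l)%N.
Hypothesis a1K : is_mx_inverse (mxsub f f S1) a1i.
Hypothesis a2K : is_mx_inverse (mxsub f f S2) a2i.
Local Notation D1 := (mxsub h h S1 - mxsub h f S1 *m a1i *m mxsub f h S1).
Local Notation D2 := (mxsub h h S2 - mxsub h f S2 *m a2i *m mxsub f h S2).
Variables (D2i : 'M[B]_l) (ti : 'M[B]_(k + l)) (at_i : 'M[B]_k).
Hypothesis D2K : is_mx_inverse D2 D2i.
Hypothesis tK : is_mx_inverse (mxsub e e S2) ti.
Hypothesis atK : (mxsub f f S)^T *m at_i = 1%:M.
Hypothesis FE : F *+ k = \tr (a1i *m mxsub f f S).
Hypothesis F1 : k = 0%N -> F = 1.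

Let fE i : f i = i :> nat. Proof. exact: eE. Qed.
Let hE i : h i = (k + i)%N :> nat. Proof. exact: eE. Qed.

(** Elimination in the last block column of t t^-1 = 1: the upper part is determined by the lower
    one, and the Schur complement times the lower part is 1. *)
Lemma drsubmx_inverse j q : ti (rshift k j) (rshift k q) = D2i j q.
Proof.
have [tiK _] := tK; have [_ a2iK] := a2K; have [_ D2iK] := D2K.
pose x := ursubmx ti; pose y := drsubmx ti.
have tE p (u : 'I_p -> 'I_(k + l)) :
   mxsub (e \o u) f S2 *m x + mxsub (e \o u) h S2 *m y = mxsub u (@rshift k l) (1%:M : 'M_(k + l)).
  rewrite -tiK; apply/matrixP=> i s; rewrite !mxE big_split_ord /=.
  by congr (_ + _); apply: eq_bigr => v _; rewrite !mxE.
have fx : x = - (a2i *m mxsub f h S2 *m y).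
  have := congr1 (fun X => a2i *m X) (tE _ (@lshift k l)).
  rewrite mulmxDr !mulmxA a2iK mul1mx => E.
  have z : mxsub (@lshift k l) (@rshift k l) (1%:M : 'M[B]_(k + l)) = 0.
    by apply/matrixP=> i s; rewrite !mxE eq_lrshift.
  by move: E; rewrite z mulmx0 => /eqP; rewrite addr_eq0 => /eqP.
have := tE _ (@rshift k l); rewrite fx mulmxN !mulmxA addrC -mulmxBl.
have -> : mxsub (@rshift k l) (@rshift k l) (1%:M : 'M[B]_(k + l)) = 1%:M.
  by apply/matrixP=> i s; rewrite !mxE (inj_eq (@rshift_inj _ _)).
move=> /(congr1 (fun X => D2i *m X)); rewrite mulmxA D2iK mul1mx mulmx1 => E.
by have /matrixP/(_ j q) := E; rewrite !mxE.
Qed.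

Let comm_corner_Schur S' x i j : gl_rel x S' S2 -> (0 < x)%N ->
  bracket (mxsub f f S' i j) D2 = 0.
Proof.
move=> S'S2 x0; have [K1 K2] := a2K.
have : bracket (mxsub f f S' i j) D2 *+ x = 0.
  apply: (bracket_Schur0 (b := mxsub f h S') (c := mxsub h f S') K1 K2);
    apply: bracket_gl_rel S'S2 _ _ i j => u v; rewrite ?hE ?fE;
    by have := ltn_ord u; have := ltn_ord v; lia.
move=> /matrixP D0; apply/matrixP=> u v; apply: (cancel x0).
by have := D0 u v; rewrite mulmxnE => ->; rewrite mxE mul0rn.
Qed.

(** The trace k F is built from entries of a(u) and a(u - k)^-1; all of them commute with the Schur
    complement at u - k - l, hence with its inverse. *)
Lemma comm_trace_Schur j q : F * D2i j q = D2i j q * F.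
Proof.
have [k0|k0] := posnP k; first by rewrite F1 // mul1r mulr1.
have cS s t : S (f s) (f t) * D2i j q = D2i j q * S (f s) (f t).
  have := comm_corner_Schur s t SS2; rewrite addn_gt0 k0 => /(_ isT)/(bracket0_inv D2K)/bracket0P.
  by rewrite mxsub_entry => ->.
have cS1 s t : a1i s t * D2i j q = D2i j q * a1i s t.
  suff /(bracket0_inv a1K)/bracket0P -> : bracket (D2i j q) (mxsub f f S1) = 0 by [].
  apply/bracket0P => u v; have := comm_corner_Schur u v S12 l_gt0.
  by move=> /(bracket0_inv D2K)/bracket0P ->.
apply: (cancel k0); rewrite -mulrnAl -mulrnAr FE mulr_suml mulr_sumr.
apply: eq_bigr => s _; rewrite mxE mulr_suml mulr_sumr; apply: eq_bigr => t _.
by rewrite mxsub_entry -mulrA cS !mulrA cS1.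
Qed.

(** The Liouville formula for the corner of size k + l is split along k and l. Its entries with i
    among the first k and q among the last l are zero, which determines the upper right block of
    [ti] by the lower right one; the entries with i = q among the last l then become F times a sum
    of products of entries of D2^-1 and D1. *)
Lemma trace_corner_step :
  \tr (ti *m mxsub e e S) *+ l = (F * \tr (D2i *m D1)) *+ (k + l).
Proof.
have [tiK1 tiK2] := tK.
have Het : bracket_rel (k + l) S S2 e e e e.
  apply: bracket_gl_rel SS2 _ _ => u v; rewrite !eE;
  by have := ltn_ord u; have := ltn_ord v; lia.
have tr i q := quantum_Liouville i q tiK1 tiK2 Het.
have tr' i q : (\sum_j ti (lshift l j) q * S (e i) (f j)
      + \sum_j ti (rshift k j) q * S (e i) (h j)) *+ (k + l)
    = \tr (ti *m mxsub e e S) * (i == q)%:R.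
  by rewrite -tr big_split_ord /=; congr ((_ + _) *+ _);
    apply: eq_bigr => j _; rewrite mxsub_entry.
have kl0 : (0 < k + l)%N by rewrite addn_gt0 l_gt0 orbT.
pose E := a1i *m mxsub f h S1.
have le_kl : (k + k + l <= N)%N by lia.
have up := Schur_upper fE hE SS1 a1K le_kl l_gt0.
have low := Schur_lower fE hE SS1 a1K le_kl l_gt0 S0 F1 FE.
(* By [Schur_upper] the vanishing entries say that y times the transposed corner is zero; that
   factor is cancelled by its right inverse [at_i]. *)
have til q s : ti (lshift l s) (rshift k q)
    = - \sum_j ti (rshift k j) (rshift k q) * E s j.
  pose y := \row_s (ti (lshift l s) (rshift k q) + \sum_j ti (rshift k j) (rshift k q) * E s j).
  have : y *m (mxsub f f S)^T = 0.
    apply/matrixP=> u v; rewrite [LHS]mxE [RHS]mxE.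
    under eq_bigr => s0 _ do rewrite [y _ _]mxE [_^T _ _]mxE mxsub_entry mulrDl.
    apply: (cancel kl0); rewrite mul0rn.
    transitivity (\tr (ti *m mxsub e e S) * (lshift l v == rshift k q)%:R); last first.
      by rewrite eq_lrshift mulr0.
    rewrite -tr'; congr (_ *+ _).
    rewrite big_split /=; congr (_ + _).
    under [RHS]eq_bigr do rewrite up mulr_sumr.
    rewrite exchange_big; apply: eq_bigr => w _; rewrite mulr_suml.
    by apply: eq_bigr => j _; rewrite mulrA.
  move=> /(congr1 (fun X => X *m at_i)); rewrite -mulmxA atK mulmx1 mul0mx.
  by move/matrixP/(_ 0 s); rewrite !mxE => /eqP; rewrite addr_eq0 => /eqP.
have diag q : (F * \sum_j D2i j q * D1 q j) *+ (k + l) = \tr (ti *m mxsub e e S).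
  have := tr' (rshift k q) (rshift k q); rewrite eqxx mulr1 => <-; congr (_ *+ _); apply/esym.
  under eq_bigr do rewrite til mulNr mulr_suml.
  rewrite sumrN addrC exchange_big /= -sumrB mulr_sumr; apply: eq_bigr => j _.
  (* F is moved past D2^-1 to stand directly before D1, where [Schur_lower] absorbs it. *)
  rewrite mulrA comm_trace_Schur -mulrA -low -drsubmx_inverse mulrBr mulr_sumr.
  by congr (_ - _); apply: eq_bigr => s _; rewrite mulrA.
transitivity (\sum_(q < l) (F * \sum_j D2i j q * D1 q j) *+ (k + l)).
  by rewrite (eq_bigr _ (fun q _ => diag q)) sumr_const card_ord.
rewrite sumrMnl -mulr_sumr exchange_big; congr ((_ * _) *+ _).
by apply: eq_bigr => j _; rewrite [RHS]mxE.
Qed.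

End Step.
End GlRelations.

(** * Elimination in the equation for z(u) *)

Section CornerOfInverse.
Variables (B : nzRingType) (N kr k l : nat).
Variables (fr : 'I_kr -> 'I_N) (f : 'I_k -> 'I_N) (h : 'I_l -> 'I_N).
Hypothesis NE : N = (kr + l + k)%N.
Hypotheses (frE : forall i, fr i = i :> nat) (fE : forall i, f i = i :> nat).
Hypothesis hE : forall i, h i = (k + i)%N :> nat.
Local Notation hr := (fun q => rev_ord (h (rev_ord q))).
Variables (T X S : 'M[B]_N) (ari : 'M[B]_kr) (Dr : 'M[B]_l) (D' : 'M[B]_l).
Variables (z F : B) (sgn : 'I_N -> B) (e : 'M[B]_(k, l)).
Hypothesis sgnC : forall i b, sgn i * b = b * sgn i.
Hypothesis sgn2 : forall i, sgn i * sgn i = 1.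
Hypothesis XE : forall i j, X (rev_ord i) (rev_ord j) = sgn j * sgn i * S j i.
Hypothesis XT : X *m T = z%:M.
Hypothesis ariK : mxsub fr fr T *m ari = 1%:M.
Hypothesis DrE : Dr = mxsub hr hr T - mxsub hr fr T *m ari *m mxsub fr hr T.
Hypothesis up : forall p j, S (f p) (h j) = \sum_s e s j * S (f p) (f s).
Hypothesis low : forall p j, S (h p) (h j) - \sum_s e s j * S (h p) (f s) = F * D' p j.

(** X, T, S stand for T^t(u + kappa), T(u), T(u + kappa). From X T = z follows X W = z V. The last k
    rows of W are unknown; the rows i' of this equation with i in the range of [f], where V
    vanishes, eliminate them from the rows with i in the range of [h]. *)
Lemma corner_of_inverse p q :
  F * (\sum_j sgn (h p) * sgn (h j) * D' j p * Dr (rev_ord j) q)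
    = z * (rev_ord p == q)%:R.
Proof.
have hrE i : hr i = (kr + i)%N :> nat.
  by rewrite /= hE /=; have := ltn_ord i; lia.
pose h3 (s : 'I_k) := rev_ord (f (rev_ord s)).
have h3E i : h3 i = (kr + l + i)%N :> nat.
  by rewrite /h3 /= fE /=; have := ltn_ord i; lia.
(* T V vanishes on the first kr rows and is Dr on the next l rows. *)
pose V := colsub hr 1%:M - colsub fr 1%:M *m (ari *m mxsub fr hr T).
pose W := T *m V.
have WE : W = colsub hr T - colsub fr T *m (ari *m mxsub fr hr T).
  by rewrite /W /V mulmxBr [_ *m (colsub fr _ *m _)]mulmxA !mulmx_colsub !mulmx1.
have rowW m (r : 'I_m -> 'I_N) :
    rowsub r W = mxsub r hr T - mxsub r fr T *m (ari *m mxsub fr hr T).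
  have rowsubB (U U' : 'M[B]_(N, l)) : rowsub r (U - U') = rowsub r U - rowsub r U'.
    by apply/matrixP=> a b; rewrite !mxE.
  by rewrite WE rowsubB -mul_rowsub_mx -!mxsubrc.
have W0 s : W (fr s) q = 0.
  have /matrixP/(_ s q) : rowsub fr W = 0 by rewrite rowW mulmxA ariK mul1mx subrr.
  by rewrite !mxE.
have WD j : W (hr j) q = Dr j q.
  have /matrixP/(_ j q) : rowsub hr W = Dr by rewrite rowW DrE -mulmxA.
  by rewrite mxE.
pose Y t := sgn (f t) * W (rev_ord (f t)) q.
have XW i : z * V (rev_ord i) q
    = sgn i * (\sum_j sgn (h j) * S (h j) i * Dr (rev_ord j) q + \sum_t S (f t) i * Y t).
  transitivity ((X *m W) (rev_ord i) q).
    by rewrite /W mulmxA XT mul_scalar_mx [RHS]mxE.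
  rewrite mxE (sum_split3 _ NE frE hrE h3E) big1 ?add0r => [|s _]; last by rewrite W0 mulr0.
  rewrite mulrDr !mulr_sumr [in RHS](reindex_inj rev_ord_inj).
  rewrite [X in _ + X = _](reindex_inj rev_ord_inj).
  congr (_ + _); apply: eq_bigr => j _.
    by rewrite WD rev_ordK XE !mulrA (sgnC i).
  rewrite /h3 rev_ordK XE /Y [sgn (f j) * _]sgnC -!mulrA; congr (_ * _).
  by rewrite [RHS]mulrA -sgnC -mulrA.
have Vf s : V (rev_ord (f s)) q = 0.
  rewrite mx_subE mxE [X in _ - X]mxE mxE big1 ?subr0 => [|j _].
    case: eqP => // /(congr1 (@nat_of_ord _)); rewrite hrE /= fE.
    by have := ltn_ord s; have := ltn_ord q; lia.
  rewrite !mxE; case: eqP => [/(congr1 (@nat_of_ord _))|]; last by rewrite mul0r.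
  by rewrite frE /= fE; have := ltn_ord s; have := ltn_ord j; lia.
have Vh : V (rev_ord (h p)) q = (rev_ord p == q)%:R.
  rewrite mx_subE mxE [X in _ - X]mxE mxE big1 ?subr0 => [|j _].
    rewrite (inj_eq rev_ord_inj) -(inj_eq (@ord_inj _)) !hE eqn_add2l (inj_eq (@ord_inj _)).
    by rewrite -(inj_eq rev_ord_inj) rev_ordK.
  rewrite !mxE; case: eqP => [/(congr1 (@nat_of_ord _))|]; last by rewrite mul0r.
  by rewrite frE /= hE; have := ltn_ord p; have := ltn_ord j; lia.
have Yf s : \sum_t S (f t) (f s) * Y t
    = - \sum_j sgn (h j) * S (h j) (f s) * Dr (rev_ord j) q.
  have /(congr1 (fun v => sgn (f s) * v)) := XW (f s).
  rewrite Vf mulr0 mulr0 mulrA sgn2 mul1r addrC => /esym/eqP.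
  by rewrite addr_eq0 => /eqP.
rewrite -Vh XW mulr_sumr.
(* [up] expresses the entries of S in column h(p) through those in the columns f(s), and [Yf] then
   replaces the unknown rows. *)
have -> : \sum_t S (f t) (h p) * Y t
    = - \sum_j \sum_s e s p * (sgn (h j) * S (h j) (f s) * Dr (rev_ord j) q).
  under eq_bigr do rewrite up mulr_suml; rewrite exchange_big /=.
  rewrite [in RHS]exchange_big /= -sumrN; apply: eq_bigr => s _.
  by rewrite -mulr_sumr -mulrN -Yf mulr_sumr; apply: eq_bigr => t _; rewrite -mulrA.
rewrite -sumrB mulr_sumr; apply: eq_bigr => j _.
transitivity (sgn (h p) * (sgn (h j) * ((F * D' j p) * Dr (rev_ord j) q))).
  by rewrite !mulrA -(sgnC _ F) -[sgn (h p) * F * _]mulrA -(sgnC _ F) !mulrA.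
rewrite -low mulrBl mulrBr !mulrA; congr (_ * (_ - _)).
rewrite mulr_sumr mulr_suml; apply: eq_bigr => s _.
by rewrite !mulrA (sgnC _ (e s p)).
Qed.
End CornerOfInverse.

Lemma mulrn_inj (K : numFieldType) (V : lmodType K) k (v w : V) :
  (0 < k)%N -> v *+ k = w *+ k -> v = w.
Proof.
move=> k0; rewrite -!scaler_nat; apply: scalerI.
by rewrite pnatr_eq0 -lt0n.
Qed.

Lemma mul_scale_natV (K : numFieldType) (A : algType K) l (x y : A) :
  (0 < l)%N -> (x * (l%:R^-1 *: y)) *+ l = x * y.
Proof.
move=> l0; rewrite -scalerAr -scaler_nat scalerA divff ?scale1r //.
by rewrite pnatr_eq0 -lt0n.
Qed.

(** The factors need not commute, so the last one has to leave on the right. [G] extends F by 1 to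
    all natural numbers, which turns the filtered product into one over an initial segment. *)
Lemma prod_ltnS (R : nzRingType) M (F : 'I_M -> R) (a : 'I_M) :
  \prod_(b < M | (b < a.+1)%N) F b = (\prod_(b < M | (b < a)%N) F b) * F a.
Proof.
pose G b := odflt 1 (omap F (insub b)).
have FG m : (m <= M)%N -> \prod_(b < M | (b < m)%N) F b = \prod_(b < m) G b.
  move=> lem; rewrite (big_ord_widen M G lem).
  by apply: eq_bigr => b _; rewrite /G valK.
by rewrite !FG ?(ltnW (ltn_ord a)) // big_ord_recr /= {2}/G valK.
Qed.

Lemma map_is_mx_inverse (R R' : nzRingType) (phi : {rmorphism R -> R'}) p (X Y : 'M[R]_p) :
  is_mx_inverse X Y -> is_mx_inverse (map_mx phi X) (map_mx phi Y).
Proof. by move=> [XY YX]; split; rewrite -map_mxM ?XY ?YX map_mx1. Qed.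

(** * The product formula *)

Section TraceProduct.
Variables (K : numFieldType) (A : algType K) (N M : nat) (nu : 'I_M -> nat).
Local Notation B := (series A).
Variables (T : 'M[B]_N) (sh : nat -> {rmorphism B -> B}).
Hypothesis gl : forall x m, (x.*2 < N)%N ->
  gl_rel x (map_mx (sh m) T) (map_mx (sh (m + x)%N) T).
Hypothesis T0 : forall i j, (T i j)`[0] = (i == j)%:R.
Hypothesis sh0 : forall m f, (sh m f)`[0] = f`[0].
Hypothesis NE : N = (\sum_(a < M) nu a)%N.
Hypothesis nu_gt0 : forall a, (0 < nu a)%N.
Variables (F E : 'M[B]_(\sum_(a < M) nu a)) (D Dinv : forall a, 'M[B]_(nu a)).
Hypothesis Gauss : block_Gauss (castmx (NE, NE) T) F D E.
Hypothesis DK : forall a, is_mx_inverse (D a) (Dinv a).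
Local Notation S m := (map_mx (sh m) T).
Local Notation factor a := ((nu a)%:R^-1 *:
  \tr (map_mx (sh (psum nu a.+1)) (Dinv a) *m map_mx (sh (psum nu a)) (D a))).

Let cancel k (v w : B) : (0 < k)%N -> v *+ k = w *+ k -> v = w.
Proof. exact: mulrn_inj. Qed.

Lemma corner_inverse k (e : 'I_k -> 'I_N) :
  (forall i, e i = i :> nat) -> exists Y, is_mx_inverse (mxsub e e T) Y.
Proof.
move=> eE; apply: mx_series_inverse => i j; rewrite mxE T0; congr (_ %:R)%R.
by rewrite -!(inj_eq (@ord_inj _)) !eE.
Qed.

(** Over a noncommutative ring the transposed inverse need not invert the transpose, so the constant
    term is used again. *)
Lemma corner_tr_inverse k (e : 'I_k -> 'I_N) m :
  (forall i, e i = i :> nat) -> exists Y, (mxsub e e (S m))^T *m Y = 1%:M.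
Proof.
move=> eE; have [|Y [XY _]] := @mx_series_inverse _ _ (mxsub e e (S m))^T; last by exists Y.
move=> i j; rewrite !mxE sh0 T0; congr (_ %:R)%R.
by rewrite -!(inj_eq (@ord_inj _)) !eE eq_sym.
Qed.

Lemma psum_eq0 a : (a <= M)%N -> psum nu a = 0%N -> a = 0%N.
Proof.
case: a => // a ltaM E0; have := leq_psum nu (leq0n a); have := psumS nu (Ordinal ltaM).
by rewrite E0 /=; have := nu_gt0 (Ordinal ltaM); lia.
Qed.

(** Here [sh m] plays the role of the shift by kappa - m. Induction on the number of blocks:
    [trace_corner_step], with F the product over the first a blocks, appends the next factor. For a
    = 0 both sides are zero, the matrix being empty. *)
Lemma trace_product a k (e : 'I_k -> 'I_N) ti :
    (a <= M)%N -> k = psum nu a -> (k.*2 < N)%N -> (forall i, e i = i :> nat) ->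
    is_mx_inverse (mxsub e e T) ti ->
  \tr (map_mx (sh k) ti *m mxsub e e (S 0%N))
    = (\prod_(b < M | (b < a)%N) factor b) *+ k.
Proof.
elim: a k e ti => [|a IHa] k e ti leaM kE ltkN eE tK.
  have k0 : k = 0%N by rewrite kE psum0.
  have nk : ~ (0 < k)%N by rewrite k0.
  rewrite [X in _ = _ *+ X]k0 mulr0n /mxtrace big1 // => i _.
  by case: nk; apply: leq_ltn_trans (ltn_ord i).
pose b := Ordinal leaM; have kE' : k = (psum nu b + nu b)%N by rewrite kE -(psumS nu b).
(* The size becomes a sum inside the types, so that the corner splits; from here on k is the size of
   the smaller corner. *)
move: kE; rewrite kE' in e ti ltkN eE tK * => kE {k kE'}.
set k := psum nu b in e ti ltkN eE tK kE *; set l := nu b in e ti ltkN eE tK kE *.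
pose f i := e (lshift l i); pose h i := e (rshift k i).
have fE i : f i = i :> nat by rewrite /f eE.
have hE i : h i = (k + i)%N :> nat by rewrite /h eE.
have [ai aK] := corner_inverse fE.
have [at_i atK] := corner_tr_inverse 0%N fE.
have ltk : (k.*2 < N)%N by lia.
have IH := IHa k f ai (ltnW leaM) erefl ltk fE aK.
set P := \prod_(c < M | (c < a)%N) factor c in IH.
have DE : mxsub h h T - mxsub h f T *m ai *m mxsub f h T = D b.
  by apply: block_Gauss_Schur Gauss _ _ _ _ fE hE _; case: aK.
have DmE m : mxsub h h (S m) - mxsub h f (S m) *m map_mx (sh m) ai *m mxsub f h (S m)
    = map_mx (sh m) (D b).
  by rewrite -DE map_mxB !map_mxM !map_mxsub.
have aKm m : is_mx_inverse (mxsub f f (S m)) (map_mx (sh m) ai).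
  by rewrite -map_mxsub; apply: map_is_mx_inverse.
have tKm m : is_mx_inverse (mxsub e e (S m)) (map_mx (sh m) ti).
  by rewrite -map_mxsub; apply: map_is_mx_inverse.
have l0 : (0 < l)%N by apply: nu_gt0.
have k0S : k = 0%N -> S 0%N = S k by move=> ->.
have k0P : k = 0%N -> P = 1.
  by move=> /(psum_eq0 (ltnW leaM)) a0; rewrite /P big_pred0 // => i; rewrite a0.
have DKm : is_mx_inverse (mxsub h h (S (k + l)%N)
    - mxsub h f (S (k + l)%N) *m map_mx (sh (k + l)%N) ai *m mxsub f h (S (k + l)%N))
    (map_mx (sh (k + l)%N) (Dinv b)).
  by rewrite DmE; apply/map_is_mx_inverse/DK.
have := trace_corner_step cancel eE (gl 0 ltk) k0S (gl 0 ltkN) (gl k (_ : l.*2 < N)%N) _ l0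
  (aKm k) (aKm (k + l)%N) DKm (tKm _) atK (esym IH) k0P.
rewrite DmE => step; apply: (cancel l0); rewrite step; try lia.
rewrite (prod_ltnS (fun c => factor c) b) -/P -mulrnA mulnC mulrnA; congr (_ *+ _).
by rewrite (mul_scale_natV _ _ l0) kE.
Qed.

Lemma block_Gauss_Schur_cast (a : 'I_M) l (el : nu a = l) (f : 'I_(psum nu a) -> 'I_N)
    (h : 'I_l -> 'I_N) ai :
    (forall i, f i = i :> nat) -> (forall i, h i = psum nu a + i :> nat)%N ->
    mxsub f f T *m ai = 1%:M ->
  castmx (el, el) (D a) = mxsub h h T - mxsub h f T *m ai *m mxsub f h T.
Proof. by subst l; move=> fE hE aK; rewrite (block_Gauss_Schur Gauss fE hE aK). Qed.

Variables (z : B) (X : 'M[B]_N) (sgn : nat -> B).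
Hypothesis sgnC : forall i b, sgn i * b = b * sgn i.
Hypothesis sgn2 : forall i, sgn i * sgn i = 1.
Hypothesis XE : forall i j, X (rev_ord i) (rev_ord j) = sgn j * sgn i * S 0%N j i.
Hypothesis XT : X *m T = z%:M.
Hypothesis nu_sym : forall a, nu (rev_ord a) = nu a.

(** [corner_of_inverse], with F the product given by [trace_product]. From c <= r one has 2k + l <=
    N, which keeps Q-terms out of the relations used. The entries with q = p' are summed over p,
    giving l copies of z, and l is cancelled. *)
Lemma product_corner (c r : 'I_M) (el : nu r = nu c) (V : 'M[B]_(nu c)) :
    r = rev_ord c -> (c <= r)%N ->
    (forall p q, V (rev_ord p) (rev_ord q)
       = sgn (psum nu c + q)%N * sgn (psum nu c + p)%N
         * map_mx (sh (psum nu c)) (D c) q p) ->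
  z = (\prod_(b < M | (b < c)%N) factor b)
      * ((nu c)%:R^-1 *: \tr (V *m castmx (el, el) (D r))).
Proof.
move=> rE le_cr VE; set k := psum nu c; set l := nu c.
have NE' : N = (psum nu r + l + k)%N by rewrite NE -(psum_rev c nu_sym) rE.
have le_k : (k <= psum nu r)%N by apply: leq_psum.
have l0 : (0 < l)%N by apply: nu_gt0.
have le_klN : (k + l <= N)%N by lia.
have le_rN : (psum nu r <= N)%N by lia.
pose e := widen_ord le_klN; pose fr := widen_ord le_rN.
have eE i : e i = i :> nat by [].
have frE i : fr i = i :> nat by [].
pose f i := e (lshift l i); pose h i := e (rshift k i).
have fE i : f i = i :> nat by [].
have hE i : h i = (k + i)%N :> nat by [].
pose hr q := rev_ord (h (rev_ord q)).
have hrE i : hr i = (psum nu r + i)%N :> nat.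
  by rewrite /= NE'; have := ltn_ord i; rewrite -/l; lia.
have [ai aK] := corner_inverse fE.
have [ari arK] := corner_inverse frE.
have ltk : (k.*2 < N)%N by lia.
have IH := trace_product (ltnW (ltn_ord c)) erefl ltk fE aK.
set P := \prod_(b < M | _) _ in IH *.
have k0S : k = 0%N -> S 0%N = S k by move=> ->.
have k0P : k = 0%N -> P = 1.
  by move=> /(psum_eq0 (ltnW (ltn_ord c))) a0; rewrite /P big_pred0 // => i; rewrite a0.
have aKk : is_mx_inverse (mxsub f f (S k)) (map_mx (sh k) ai).
  by rewrite -map_mxsub; apply: map_is_mx_inverse.
have le_kl : (k + k + l <= N)%N by lia.
have up := Schur_upper cancel fE hE (gl 0 ltk) aKk le_kl l0.
have low := Schur_lower cancel fE hE (gl 0 ltk) aKk le_kl l0 k0S k0P (esym IH).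
have DE : mxsub h h T - mxsub h f T *m ai *m mxsub f h T = D c.
  by apply: block_Gauss_Schur Gauss _ _ _ _ fE hE _; case: aK.
have DkE : mxsub h h (S k) - mxsub h f (S k) *m map_mx (sh k) ai *m mxsub f h (S k)
    = map_mx (sh k) (D c).
  by rewrite -DE map_mxB !map_mxM !map_mxsub.
have DrE := block_Gauss_Schur_cast el frE hrE (proj1 arK).
have := @corner_of_inverse _ _ _ _ _ fr f h NE' frE fE hE T X (S 0%N) ari _ _ z P
  (fun i => sgn i) _ (fun i => sgnC i) (fun i => sgn2 i) XE XT (proj1 arK) DrE up low.
rewrite DkE => main; apply: (cancel l0); rewrite (mul_scale_natV _ _ l0).
transitivity (\sum_(p < l) z * (rev_ord p == rev_ord p)%:R).
  by under eq_bigr do rewrite eqxx mulr1; rewrite sumr_const card_ord.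
rewrite /mxtrace [in RHS](reindex_inj rev_ord_inj) mulr_sumr; apply: eq_bigr => p _.
rewrite -main; congr (_ * _); rewrite mxE [RHS](reindex_inj rev_ord_inj).
by apply: eq_bigr => j _; rewrite VE -!hE (sgnC (h j)).
Qed.

End TraceProduct.

(** * Matrices satisfying the RTT relation, and the extended Yangian *)

Section ShiftedRelations.
Variables (K : numFieldType) (g : BC_type) (n : nat) (A : algType K).
Local Notation N := (dimN g n).
Local Notation kap := (kappa K g n).
Variable T : 'M[series A]_N.

(** In type B kappa = n - 1/2 is no integer; in type C kappa = n + 1, while x < n. *)
Lemma natr_neq_kappa x : (x.*2 < N)%N -> x%:R != kap.
Proof.
have two0 : (2 : K) != 0 by rewrite pnatr_eq0.
rewrite /kappa; case: g => /= ltx; apply/eqP => /(congr1 (fun y => y * 2)).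
  rewrite mulrBl divfK // mul1r => /eqP; rewrite eq_sym subr_eq -natrM -natrD eqr_nat.
  by move=> /eqP; lia.
rewrite mulrDl divfK // mul1r => /eqP; rewrite -natrM -natrD eqr_nat.
by move=> /eqP; lia.
Qed.

(** For m = 0 this gives the argument u + kappa of T^t; for m = [psum nu a] it is the shift by
    [kappa_ K g n nu a]. *)
Definition shift_sub (m : nat) : {rmorphism series A -> series A} := shift (kap - m%:R).

(** The two arguments differ by x, which is not kappa, and the bounds in [gl_rel] exclude p = i' and
    q = j'. *)
Lemma shift_gl_rel : RTT_lhs T = RTT_rhs T -> forall x m, (x.*2 < N)%N ->
  gl_rel x (map_mx (shift_sub m) T) (map_mx (shift_sub (m + x)%N) T).
Proof.
move=> RTT x m ltx i j p q ltip ltjq.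
have xE : x%:R = (kap - m%:R) - (kap - (m + x)%:R) :> K.
  by rewrite natrD opprB addrC addrA subrK addrC addKr.
rewrite -scaler_nat [X in X *: _]xE; apply: (RTT_specialised RTT).
- by apply/eqP=> E; move: ltip; rewrite E /=; have := ltn_ord i; lia.
- by apply/eqP=> E; move: ltjq; rewrite E /=; have := ltn_ord j; lia.
by rewrite -xE natr_neq_kappa.
Qed.

Lemma scoef0_shift c (f : series A) : (shift c f)`[0] = f`[0].
Proof. by rewrite /= big_ord1 expr0 scale1r. Qed.

Lemma eps_comm i (b : series A) : eps (series A) g n i * b = b * eps (series A) g n i.
Proof.
rewrite /eps; case: g => //; first by rewrite mul1r mulr1.
by case: ifP => _; rewrite ?mulN1r ?mulrN1 ?mul1r ?mulr1.
Qed.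

Lemma eps_sq i : eps (series A) g n i * eps (series A) g n i = 1.
Proof. by rewrite /eps; case: g => //; [|case: ifP => _]; rewrite ?mulrNN mul1r. Qed.

Lemma eps_tr_map_rev (phi : {rmorphism series A -> series A}) o p (X : 'M[series A]_p) i j :
  map_mx phi (eps_tr g n o X) (rev_ord i) (rev_ord j)
    = eps (series A) g n (o + j) * eps (series A) g n (o + i) * map_mx phi X j i.
Proof.
have phi_eps k : phi (eps (series A) g n k) = eps (series A) g n k.
  by rewrite /eps; case: g; [|case: ifP => _]; rewrite ?rmorphN rmorph1.
by rewrite !mxE !rev_ordK 2!rmorphM !phi_eps.
Qed.

Lemma shift_sub0 f : shift_sub 0 f = shift kap f.
Proof. by rewrite -[LHS]/(shift (kap - 0%:R) f) subr0. Qed.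

(** This serves both parities of M: r = c is the middle block if M is odd, and for even M the block
    r can be the one just after c. *)
Lemma product_formula (M : nat) (nu : 'I_M -> nat)
    (nu_gt0 : forall a, (0 < nu a)%N) (nu_sum : N = (\sum_(a < M) nu a)%N)
    (nu_sym : forall a, nu (rev_ord a) = nu a)
    (F E : 'M[series A]_(\sum_(a < M) nu a))
    (D Dinv : forall a : 'I_M, 'M[series A]_(nu a)) (z : series A)
    (c r : 'I_M) (el : nu r = nu c) :
  RTT_lhs T = RTT_rhs T -> (forall i j, (T i j)`[0] = (i == j)%:R) ->
  block_Gauss (castmx (nu_sum, nu_sum) T) F D E ->
  (forall a, is_mx_inverse (D a) (Dinv a)) ->
  map_mx (shift kap) (eps_tr g n 0 T) *m T = z%:M ->
  r = rev_ord c -> (c <= r)%N ->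
  let kap := kappa_ K g n nu in
  z = (\prod_(a < M | (a < c)%N)
         ((nu a)%:R^-1 *: \tr (map_mx (shift (kap a.+1)) (Dinv a)
                          *m map_mx (shift (kap a)) (D a))))
      * ((nu c)%:R^-1 *:
           \tr (map_mx (shift (kap c)) (eps_tr g n (psum nu c) (D c))
                 *m castmx (el, el) (D r))).
Proof.
move=> RTT T0 Gauss DK zE rE le_cr /=.
have XE i j : map_mx (shift kap) (eps_tr g n 0 T) (rev_ord i) (rev_ord j)
    = eps _ g n j * eps _ g n i * map_mx (shift_sub 0) T j i.
  rewrite eps_tr_map_rev; congr (_ * _).
  by rewrite [LHS]mxE [RHS]mxE shift_sub0.
apply: (product_corner (shift_gl_rel RTT) T0 _ nu_gt0 Gauss DK
  eps_comm eps_sq XE zE nu_sym _ rE le_cr).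
  by move=> m f; apply: scoef0_shift.
by move=> p q; apply: eps_tr_map_rev.
Qed.

End ShiftedRelations.

Theorem theorem5p2 (R : realType) (g : BC_type) (n : nat) (n_gt0 : (0 < n)%N)
    (M : nat) (nu : 'I_M -> nat)
    (nu_gt0 : forall a, (0 < nu a)%N)
    (nu_sum : dimN g n = (\sum_(a < M) nu a)%N)
    (nu_sym : forall a, nu (rev_ord a) = nu a)
    (F E : 'M[series (extYangian R[i] g n)]_(\sum_(a < M) nu a))
    (D Dinv : forall a : 'I_M, 'M[series (extYangian R[i] g n)]_(nu a))
    (z : series (extYangian R[i] g n)) :
  block_Gauss (castmx (nu_sum, nu_sum) (Tmx R[i] g n)) F D E ->
  (forall a, is_mx_inverse (D a) (Dinv a)) ->
  map_mx (shift (kappa R[i] g n)) (eps_tr g n 0 (Tmx R[i] g n)) *m Tmx R[i] g n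
    = z%:M ->
  let kap := kappa_ R[i] g n nu in
  (* the factor of the block with 0-based number a *)
  let factor (a : 'I_M) :=
    (nu a)%:R^-1 *: \tr (map_mx (shift (kap a.+1)) (Dinv a)
                          *m map_mx (shift (kap a)) (D a)) in
  (forall (m : nat) (c : 'I_M), M = m.*2.+1 -> c = m :> nat ->
     z = (\prod_(a < M | (a < m)%N) factor a)
         * ((nu c)%:R^-1 *:
              \tr (map_mx (shift (kap c)) (eps_tr g n (psum nu c) (D c))
                    *m D c)))
  /\
  (g = TypeC ->
   forall (m : nat) (c : 'I_M), M = m.*2 -> c.+1 = m ->
     z = (\prod_(a < M | (a < m.-1)%N) factor a)
         * ((nu c)%:R^-1 *:
              \tr (map_mx (shift (kap c)) (eps_tr g n (psum nu c) (D c))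
                    *m castmx (nu_sym c, nu_sym c) (D (rev_ord c))))).
Proof.
move=> Gauss DK zE kap factor.
have T0 i j : (Tmx R[i] g n i j)`[0] = (i == j)%:R by rewrite mxE.
have main c r el := product_formula nu_gt0 nu_sym (c := c) (r := r) el
  (Tmx_RTT R[i] g n) T0 Gauss DK zE.
split=> [m c ME cm|_ m c ME cm].
  subst m; have rc : c = rev_ord c by apply: ord_inj => /=; lia.
  by rewrite {1}(main c c erefl rc (leqnn _)) castmx_id.
(* Here [m.-1] is c, and the mirror image of c is the next block. *)
subst m; apply: (main c (rev_ord c) (nu_sym c) erefl).
by rewrite /=; lia.
Qed.
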